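(* Let $(\mathbf E,\|\cdot\|_{\mathbf E})$ be a Banach space with a normalized $1$-unconditional basis $(\mathbf e_i)_{i\in\mathbb N}$. Assume that the dual space $\mathbf E^*$ is strictly convex and that the following assumption holds: (H) For any $j\neq k$ in $\mathbb N$, if $T:\mathrm{span}(\mathbf e_j^*,\mathbf e_k^* )\to\mathbf E^*$ is a linear isometric embedding, then the vectors $T\mathbf e_j^*$ and $T\mathbf e_k^*$ have disjoint supports. Let $\mathcal F_1$ and $\mathcal F_2$ be two combinatorial families, and let $J:X_{\mathcal F_1,\mathbf E}^*\to X_{\mathcal F_2,\mathbf E}^*$ be an isometry. If either $J$ is $w^*$-$w^*$ continuous, or $J(Z_{\mathcal F_1,\mathbf E})=Z_{\mathcal F_2,\mathbf E}$, then there exist a permutation $\pi:\mathbb N\to\mathbb N$ with $\pi(\mathcal F_1)=\mathcal F_2$ and a sequence of signs $(\omega_i)$ such that $Je_i^*=\omega_ie_{\pi(i)}^*$ for all $i\in\mathbb N$. The second alternative, $J(Z_{\mathcal F_1,\mathbf E})=Z_{\mathcal F_2,\mathbf E}$, occurs as soon as $\mathcal F_1$ and $\mathcal F_2$ are compact. Moreover, when $\mathbb K=\mathbb C$ one can replace (H) by the assumption that $\mathrm{span}(\mathbf e_j^*,\mathbf e_k^* )$ is not isometrically equal to $\ell_2(2)$ for any $j\neq k$ in $\mathbb N$. Finally, if the families $\mathcal F_1$ and $\mathcal F_2$ are compact, then the strict convexity of $\mathbf E^*$ may be replaced by the assumption that $\|\cdot\|_{\mathbf E}$ is smooth at every finitely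 supported vector $\mathbf x\in S_{\mathbf E}$ (the unit sphere of $\mathbf E$); and it is enough to know that (H) holds for isometric embeddings $T:\mathrm{span}(\mathbf e_j^*,\mathbf e_k^* )\to\mathrm{span}(\mathbf e_i^*,\ i\in\mathbb N)$.
   Context: Scalars are in $\mathbb K=\mathbb R$ or $\mathbb C$; $\mathbb N=\{1,2,\dots\}$. ''Isometry'' means linear surjective isometry. A sign is a scalar of modulus $1$. $(\mathbf e_i^* )$ denotes the coordinate functionals of $(\mathbf e_i)$. The basis $(\mathbf e_i)$ is $1$-unconditional: $\|\sum a_i\mathbf e_i\|_{\mathbf E}\leqslant\|\sum b_i\mathbf e_i\|_{\mathbf E}$ whenever $|a_i|\leqslant|b_i|$ for all $i$ (finitely supported). A combinatorial family is a family $\mathcal F$ of finite subsets of $\mathbb N$ containing all singletons and hereditary for inclusion; it is compact if closed in $\{0,1\}^{\mathbb N}$ (sets identified with characteristic functions). $\pi(\mathcal F)=\{\pi(F);F\in\mathcal F\}$. $c_{00}$ is the space of finitely supported scalar sequences with canonical basis $(e_i)$. $X_{\mathcal F,\mathbf E}$ is the completion of $c_{00}$ for the norm $\|x\|_{\mathcal F,\mathbf E}=\sup\{\|\sum_{i\in F}x(i)\mathbf e_i\|_{\mathbf E};\ F\in\mathcal F\}$; $(e_i)$ is a $1$-unconditional basis of $X_{\mathcal F,\mathbf E}$ with coordinate functionals $(e_i^* )$, and $Z_{\mathcal F,\mathbf E}$ is the norm-closed linear span of $\{e_i^*;i\in\mathbb N\}$ in $X_{\mathcal F,\mathbf E}^*$.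 If $Z$ is a Banach space with Schauder basis $(f_i)$, the support of $z^*\in Z^*$ is $\{i\in\mathbb N;\langle z^*,f_i\rangle\neq0\}$. For vectors $u,v$ of a normed space, $\mathrm{span}(u,v)$ is isometrically equal to $\ell_2(2)$ if $\|au+bv\|^2=|a|^2+|b|^2$ for all $a,b\in\mathbb K$. $\|\cdot\|_{\mathbf E}$ is smooth at $\mathbf x\in S_{\mathbf E}$ if there is exactly one $\mathbf x^*\in S_{\mathbf E^*}$ with $\langle\mathbf x^*,\mathbf x\rangle=1$. *)

(* Defs.v *)
From HB Require Import structures.
From mathcomp Require Import all_boot all_order all_algebra finmap.
From mathcomp Require Import complex.
From mathcomp Require Import all_classical all_reals all_analysis.

Set Implicit Arguments.
Unset Strict Implicit.
Unset Printing Implicit Defensive.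

Import Order.TTheory GRing.Theory Num.Theory.
Import numFieldNormedType.Exports.

Local Open Scope classical_set_scope.
Local Open Scope ring_scope.

Inductive scalar_kind := RealScalars | ComplexScalars.

(* The scalar field, R or C. Norms take values in the field itself, as usual
   for [normedModType]; on C the order is the one for which [x <= y] means
   that [y - x] is a nonnegative real. *)
Definition scalars (R : realType) (s : scalar_kind) : numFieldType :=
  match s with
  | RealScalars => R
  | ComplexScalars => R[i]
  end.

Lemma scalars_supremums_neq0 (R : realType) (s : scalar_kind)
    (A : set (scalars R s)) :
  A !=set0 -> (forall a, A a -> 0 <= a) -> ubound A !=set0 ->
  supremums A !=set0.
Proof.
case: s A => /= A [a Aa] A_ge0 [M AM].
  have sA : has_sup A by split; [exists a | exists M].
  exists (sup A); split; last first.
    by move=> y Ay; apply: ge_sup => //; exists a.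
  by move=> x Ax; apply: ub_le_sup => //; exists M.
have ReE z : 0 <= z -> (complex.Re z)%:C%C = z.
  by move=> z0; rewrite RRe_real// ger0_real.
pose B := [set complex.Re z | z in A].
have uB y : ubound A y -> ubound B (complex.Re y).
  move=> Ay _ [z Az <-]; have y0 := le_trans (A_ge0 _ Aa) (Ay _ Aa).
  by rewrite -lecR (ReE _ _ y0) (ReE _ _ (A_ge0 _ Az)); exact: Ay.
have B0 : B !=set0 by exists (complex.Re a); exists a.
have sB : has_sup B by split=> //; exists (complex.Re M); exact: uB.
exists (sup B)%:C%C; split=> [z Az | y Ay].
  rewrite -(ReE _ _ (A_ge0 _ Az)) lecR; apply: ub_le_sup; first exact: sB.2.
  by exists z.
have y0 := le_trans (A_ge0 _ Aa) (Ay _ Aa).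
by rewrite -(ReE _ _ y0) lecR; apply: ge_sup => //; exact: uB.
Qed.

Section Dual.
Context {R : realType} {s : scalar_kind}.
Notation K := (scalars R s).

Section DualSpace.
Variable X : normedModType K.

Definition dual_pred : {pred X -> K^o} :=
  fun f => `[< linear f /\ continuous f >].

Record dual : Type := Dual {
  dual_fun :> X -> K^o;
  dual_funP : dual_fun \in dual_pred }.

HB.instance Definition _ := [isSub for dual_fun].
HB.instance Definition _ := [Choice of dual by <:].

Lemma dual_submod_closed : submod_closed dual_pred.
Proof.
split=> [|a f g].
  apply/asboolP; split; last exact: cst_continuous.
  by move=> a x y; change (0 = a *: (0 : K^o) + 0); rewrite scaler0 addr0.
move=> /asboolP[fl fc] /asboolP[gl gc]; apply/asboolP; split.
  move=> b x y; rewrite !fctE/= fl gl !scalerDr !scalerA mulrC.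
  by rewrite -!addrA; congr (_ + _); rewrite addrCA.
move=> x; apply: cvgD; last exact: gc.
by apply: cvgZl_tmp; exact: fc.
Qed.

HB.instance Definition _ :=
  GRing.isSubmodClosed.Build K (X -> K^o) dual_pred dual_submod_closed.
HB.instance Definition _ := [SubChoice_isSubLmodule of dual by <:].

Lemma dual_continuous (f : dual) : continuous f.
Proof. by case: f => f /= /asboolP[]. Qed.

Lemma dual_linear (f : dual) : linear (f : X -> K^o).
Proof. by case: f => f /= /asboolP[]. Qed.

HB.instance Definition _ (f : dual) :=
  GRing.isLinear.Build K X K^o *:%R (dual_fun f) (dual_linear f).

Lemma dual_addE (f g : dual) x : (f + g) x = f x + g x.
Proof. by []. Qed.

Lemma dual_scaleE (a : K) (f : dual) x : (a *: f) x = a * f x.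
Proof. by []. Qed.

Definition dual_norm (f : dual) : K :=
  supremum 0 [set `|f x| | x in [set x : X | `|x| <= 1]].

Lemma dual_norm_lub (f : dual) :
  isLub [set `|f x| | x in [set x : X | `|x| <= 1]] (dual_norm f).
Proof.
set A := (X in isLub X _).
have A0 : A !=set0 by exists `|f 0|, 0 => //=; rewrite normr0.
have uA : ubound A !=set0.
  have := @continuous_linear_bounded K X K^o 0 f (@dual_continuous f 0).
  move=> /linear_boundedP/pinfty_ex_gt0[M M0 fM].
  exists M => _ [x /= x1 <-]; apply: le_trans (fM x) _.
  by rewrite ler_piMr// ltW.
have [|z zA] := scalars_supremums_neq0 A0 _ uA; first by move=> _ [x _ <-].
rewrite /dual_norm -/A /supremum ifF; last by apply/negbTE/set0P.
by case: xgetP => [y _ []//|/(_ z)/(_ zA)].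
Qed.

Lemma dual_norm_ub (f : dual) x : `|x| <= 1 -> `|f x| <= dual_norm f.
Proof. by move=> x1; apply: (dual_norm_lub f).1; exists x. Qed.

Lemma dual_norm_le (f : dual) (c : K) :
  (forall x, `|x| <= 1 -> `|f x| <= c) -> dual_norm f <= c.
Proof.
by move=> fc; apply: (dual_norm_lub f).2 => _ [x /= x1 <-]; exact: fc.
Qed.

Lemma dual_norm_ge0 (f : dual) : 0 <= dual_norm f.
Proof. by apply: le_trans (dual_norm_ub f (x := 0) _); rewrite ?normr0. Qed.

Lemma ler_dual_normD (f g : dual) :
  dual_norm (f + g) <= dual_norm f + dual_norm g.
Proof.
apply: dual_norm_le => x x1; rewrite dual_addE.
by apply: le_trans (ler_normD _ _) _; apply: lerD; exact: dual_norm_ub.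
Qed.

Lemma ler_dual_normZ (a : K) (f : dual) :
  dual_norm (a *: f) <= `|a| * dual_norm f.
Proof.
apply: dual_norm_le => x x1; rewrite dual_scaleE normrM ler_wpM2l//.
exact: dual_norm_ub.
Qed.

Lemma dual_normZ (a : K) (f : dual) : dual_norm (a *: f) = `|a| * dual_norm f.
Proof.
have [->|a0] := eqVneq a 0.
  apply/eqP; rewrite eq_le ler_dual_normZ scale0r normr0 mul0r.
  exact: dual_norm_ge0.
apply/eqP; rewrite eq_le ler_dual_normZ/=.
rewrite -ler_pdivlMl ?normr_gt0// -normfV.
by rewrite -[X in dual_norm X <= _](scalerK a0) ler_dual_normZ.
Qed.

Lemma dual_norm0_eq0 (f : dual) : dual_norm f = 0 -> f = 0.
Proof.
move=> f0; apply/val_inj/funext => x; change (f x = 0).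
have [->|x0] := eqVneq x 0; first exact: linear0.
have nx0 : `|x| != 0 by rewrite normr_eq0.
have : `|f (`|x|^-1 *: x)| <= 0.
  by rewrite -f0; apply: dual_norm_ub; rewrite normrZ normfV normr_id mulVf.
rewrite normr_le0 linearZ => /eqP/(congr1 (fun z => `|x| * z)).
by rewrite mulr0 /GRing.scale/= mulrA mulfV// mul1r.
Qed.

HB.instance Definition _ := @Lmodule_isNormed.Build K dual
  dual_norm ler_dual_normD dual_normZ dual_norm0_eq0.

(* The dual with its weak-* topology. *)
Definition weak_star : Type :=
  initial_topology (dual_fun : dual -> {ptws X -> K^o}).
HB.instance Definition _ := Topological.on weak_star.

End DualSpace.
End Dual.

Section NormedSpaces.
Context {K : numFieldType}.

Definition linear_span {V : lmodType K} (A : set V) : set V :=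
  [set v | exists (n : nat) (a : 'I_n -> K) (u : 'I_n -> V),
    (forall i, A (u i)) /\ v = \sum_(i < n) a i *: u i].

Definition strictly_convex (V : normedModType K) : Prop :=
  forall u v : V, `|u| = 1 -> `|v| = 1 -> u <> v -> `|u + v| < 2.

Definition surjective_isometry {V W : normedModType K} (J : {linear V -> W}) :=
  (forall v, `|J v| = `|v|) /\ range J = setT.

(* [T] restricts to a linear isometric embedding of the subspace [S]; its
   values outside [S] are irrelevant. *)
Definition isometric_embedding_on {V W : normedModType K}
    (S : set V) (T : V -> W) : Prop :=
  (forall (a : K) (u v : V), S u -> S v -> T (a *: u + v) = a *: T u + T v) /\
  (forall u, S u -> `|T u| = `|u|).

Definition span_is_l22 {V : normedModType K} (u v : V) : Prop :=
  forall a b : K, `|a *: u + b *: v| ^+ 2 = `|a| ^+ 2 + `|b| ^+ 2.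

Definition schauder_basis {V : normedModType K} (e : nat -> V) : Prop :=
  forall x : V, exists! a : nat -> K,
    series (fun i => a i *: e i) @ \oo --> x.

Definition one_unconditional {V : normedModType K} (e : nat -> V) : Prop :=
  forall (n : nat) (a b : nat -> K),
    (forall i, (i < n)%N -> `|a i| <= `|b i|) ->
    `|\sum_(i < n) a i *: e i| <= `|\sum_(i < n) b i *: e i|.

Definition normalized_unconditional_basis {V : normedModType K}
    (e : nat -> V) : Prop :=
  [/\ schauder_basis e, forall i, `|e i| = 1 & one_unconditional e].

End NormedSpaces.

Section C00.
Variable K : numFieldType.

Definition c00_pred : {pred nat -> K^o} :=
  fun x => `[< exists n, forall i, (n <= i)%N -> x i = 0 >].

Record c00 : Type := C00 {
  c00_fun :> nat -> K^o;
  c00_funP : c00_fun \in c00_pred }.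

HB.instance Definition _ := [isSub for c00_fun].
HB.instance Definition _ := [Choice of c00 by <:].

Lemma c00_submod_closed : submod_closed c00_pred.
Proof.
split=> [|a x y]; first by apply/asboolP; exists 0%N.
move=> /asboolP[m xm] /asboolP[n yn]; apply/asboolP; exists (maxn m n) => i.
rewrite geq_max => /andP[mi ni].
by rewrite !fctE/= xm// yn// scaler0 addr0.
Qed.

HB.instance Definition _ :=
  GRing.isSubmodClosed.Build K (nat -> K^o) c00_pred c00_submod_closed.
HB.instance Definition _ := [SubChoice_isSubLmodule of c00 by <:].

Lemma c00_delta_subproof (j : nat) :
  (fun i => (i == j)%:R : K^o) \in c00_pred.
Proof. by apply/asboolP; exists j.+1 => i /gtn_eqF ->. Qed.

Definition c00_delta (j : nat) : c00 := C00 (c00_delta_subproof j).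

End C00.

(* Finite subsets of N; indices start at 0. *)
Definition combinatorial_family (F : set {fset nat}) : Prop :=
  (forall i, F [fset i]%fset) /\
  (forall A B : {fset nat}, (A `<=` B)%fset -> F B -> F A).

Definition compact_family (F : set {fset nat}) : Prop :=
  closed [set ((fun i => i \in A) : cantor_space) | A in F].

Definition permute_family (pi : nat -> nat) (F : set {fset nat}) :
  set {fset nat} := [set [fset pi i | i in A]%fset | A in F].

Section CombinatorialSpaces.
Context {K : numFieldType} {E : normedModType K}.

(* The supremum exists: [x] being finitely supported, the set of values is
   finite. *)
Definition comb_norm (F : set {fset nat}) (e : nat -> E) (x : c00 K) : K :=
  supremum 0 [set `|\sum_(i <- A) x i *: e i| | A in F].

(* [X], with the embedding [iota], is a completion of [c00] for [comb_norm]. *)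
Definition is_comb_space (F : set {fset nat}) (e : nat -> E)
    (X : completeNormedModType K) (iota : {linear c00 K -> X}) : Prop :=
  (forall x, `|iota x| = comb_norm F e x) /\ dense (range iota).

End CombinatorialSpaces.

Section Coordinates.
Context {R : realType} {s : scalar_kind}.
Notation K := (scalars R s).

(* The coordinate functionals of a Schauder basis (unique, the basis spanning a
   dense subspace); the default value 0 is not reached. *)
Definition coordf {V : normedModType K} (e : nat -> V) (i : nat) : dual V :=
  xget 0 [set f : dual V | forall (a : nat -> K) (x : V),
    series (fun k => a k *: e k) @ \oo --> x -> f x = a i].

Definition coordf_closed_span {V : normedModType K} (e : nat -> V) :
    set (dual V) :=
  closure (linear_span (range (coordf e))).

Definition dual_support {V : normedModType K} (e : nat -> V) (f : dual V) :
  set nat := [set i | f (e i) != 0].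

Definition smooth_at {V : normedModType K} (x : V) : Prop :=
  exists! f : dual V, `|f| = 1 /\ f x = 1.

Definition weak_star_continuous {V W : normedModType K}
    (J : dual V -> dual W) : Prop :=
  continuous (J : weak_star V -> weak_star W).

(* Embeddings of the span of two coordinate functionals with values in [W];
   the case without restriction on the values is [W = setT]. *)
Definition disjoint_embeddings {E : normedModType K} (e : nat -> E)
    (W : set (dual E)) : Prop :=
  forall (j k : nat) (T : dual E -> dual E), j <> k ->
    let S := linear_span [set coordf e j; coordf e k] in
    isometric_embedding_on S T -> T @` S `<=` W ->
    dual_support e (T (coordf e j)) `&` dual_support e (T (coordf e k)) = set0.

Definition no_l22_pair {E : normedModType K} (e : nat -> E) : Prop :=
  forall j k : nat, j <> k -> ~ span_is_l22 (coordf e j) (coordf e k).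

End Coordinates.

(* Main.v *)
Require Import Defs.
From HB Require Import structures.
From mathcomp Require Import all_boot all_order all_algebra finmap.
From mathcomp Require Import complex ring lra.
From mathcomp Require Import all_classical all_reals all_analysis.
Import Order.TTheory GRing.Theory Num.Theory.
Import numFieldNormedType.Exports.
Local Open Scope classical_set_scope.
Local Open Scope ring_scope.

(* Call a functional f rigid if every splitting f = h + (f - h) with
   |h| + |f - h| = |f| is trivial; for unit vectors this is extremality in the
   dual ball, so J preserves it.  If a finite set G is not in the family, the
   norm of X is the maximum over m in G of the norms of the restrictions to the
   complement of m, so by Hahn-Banach every functional is a norm-additive sum of
   functionals vanishing at some point of G.  Hence every finite part of the
   support of a rigid functional is in the family; conversely, if the dual of E
   is strictly convex, every finitely supported functional whose support is in
   the family is rigid.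

   If {j, k} is in F1, a generic combination of e_j^* and e_k^* is rigid, so the
   supports of its image lie in the closure of F2, where the norm of X2^* is
   that of E^*: J induces an isometric embedding of span(e_j^*, e_k^* ) in E^*,
   and (H) makes J e_j^* and J e_k^* disjoint.  If {j, k} is not in F1, then
   |e_j^* + l e_k^*| = 2 for all signs l, and strict convexity forces
   disjointness.  In the complex case without (H), rotating the m-th coordinate
   of X2^*, conjugating with J and compressing to span(e_j^*, e_k^* ) gives
   contractions of this plane which, as in the Kalton-Wood theorem, make its norm
   Euclidean unless J e_j^* and J e_k^* do not meet at m.

   Expanding J^-1 e_k^* along the e_j^* and applying J, disjointness leaves one
   term, so e_k^* is a multiple of some J e_j^*; the image of F1 is then read off
   from the two support statements above. *)

Set Implicit Arguments.
Unset Strict Implicit.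
Unset Printing Implicit Defensive.

(** * The Hahn-Banach theorem *)

Section RealHahnBanach.
Variables (R : realType) (K : pzRingType) (emb : {rmorphism R -> K}).
Variables (V : lmodType K) (q : V -> R).
Hypothesis qD : forall x y, q (x + y) <= q x + q y.
Hypothesis qZ : forall r x, 0 <= r -> q (emb r *: x) = r * q x.

Let graph_closed (G : set (V * R)) := forall r u v, G u -> G v ->
  G (emb r *: u.1 + v.1, r * u.2 + v.2).
Let dominated (G : set (V * R)) := forall u, G u -> u.2 <= q u.1.

(** Zorn's lemma on graphs of partial functionals. Only real multiples [emb r] are used, so that one
    proof serves both scalar fields. *)
Lemma dominated_functional (G0 : set (V * R)) :
  G0 (0, 0) -> graph_closed G0 -> dominated G0 ->
  exists phi : V -> R,
    [/\ forall r x y, phi (emb r *: x + y) = r * phi x + phi y,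
        forall x, phi x <= q x & forall u, G0 u -> phi u.1 = u.2].
Proof.
move=> G00 clG0 dG0.
(* The case [G = set0] admits the union of the empty chain. *)
pose P (G : set (V * R)) :=
  [/\ G = set0 \/ G0 `<=` G, graph_closed G & dominated G].
have [] := @Zorn_bigcup _ P.
  move=> F FP Ft; split.
  - have [[G [FG nG]]|nF] := pselect (exists G, F G /\ G <> set0).
      right; have [[//|G0G] _ _] := FP _ FG.
      by move=> u Gu; exists G => //; exact: G0G.
    left; apply/seteqP; split=> // u [G FG Gu]; apply: nF; exists G; split=> //.
    by move=> G0'; rewrite G0' in Gu.
  - move=> r u v [A FA Au] [B FB Bv].
    have [AB|BA] := Ft _ _ FA FB.
      by exists B => //; have [_ c _] := FP _ FB; apply: c => //; exact: AB.
    by exists A => //; have [_ c _] := FP _ FA; apply: c => //; exact: BA.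
  - by move=> u [A FA Au]; have [_ _] := FP _ FA; apply.
move=> G [[G0e clG dG] Gmax].
have G0G : G0 `<=` G.
  case: G0e => // Ge; exfalso; apply: (Gmax G0); last by split=> //; right.
  rewrite Ge; split; first exact: sub0set.
  by move=> /(_ _ G00).
have Gz : G (0, 0) by exact: G0G.
have Gadd u v : G u -> G v -> G (u.1 + v.1, u.2 + v.2).
  by move=> Gu Gv; have := clG 1 _ _ Gu Gv; rewrite rmorph1 scale1r mul1r.
have Gscal r u : G u -> G (emb r *: u.1, r * u.2).
  by move=> Gu; have := clG r _ _ Gu Gz; rewrite /= !addr0.
have tot v0 : exists r, G (v0, r).
  apply: contrapT => nG.
  pose A := [set u.2 - q (u.1 - v0) | u in G].
  have Aub u : G u -> forall a, A a -> a <= q (u.1 + v0) - u.2.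
    move=> Gu _ [w Gw <-].
    have /= := qD (w.1 - v0) (u.1 + v0).
    rewrite addrCA subrK addrC => /(le_trans (dG _ (Gadd _ _ Gw Gu)))/=; lra.
  have Aneq : has_sup A.
    split; first by exists (0 - q (0 - v0)), (0, 0).
    by exists (q (0 + v0) - 0) => a /(Aub _ Gz).
  (* [c] is the value given to [v0]: it lies between all lower bounds [u.2 - q (u.1 - v0)] and all
     upper bounds [q (u.1 + v0) - u.2], which after scaling gives domination on the enlarged
     graph. *)
  pose c := sup A.
  have cle u : G u -> u.2 + c <= q (u.1 + v0).
    move=> Gu; rewrite -lerBrDl; apply: ge_sup; first exact: Aneq.1.
    exact: Aub.
  have cge u : G u -> u.2 - c <= q (u.1 - v0).
    move=> Gu; rewrite lerBlDl -lerBlDr; apply: ub_le_sup; first exact: Aneq.2.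
    by exists u.
  pose G' := [set w | exists t u, G u /\
    w = (u.1 + emb t *: v0, u.2 + t * c)].
  apply: (Gmax G'); last split.
  - split=> [u Gu|].
      by exists 0, u; split=> //; rewrite rmorph0 scale0r mul0r !addr0 -surjective_pairing.
    move=> sub; apply: nG; exists c; apply: sub; exists 1, (0, 0); split=> //.
    by rewrite rmorph1 scale1r mul1r !add0r.
  - right=> u /G0G Gu.
    by exists 0, u; split=> //; rewrite rmorph0 scale0r mul0r !addr0 -surjective_pairing.
  - move=> r _ _ [t [u [Gu ->]]] [t' [u' [Gu' ->]]] /=.
    exists (r * t + t'), (emb r *: u.1 + u'.1, r * u.2 + u'.2).
    split; first exact: clG.
    rewrite /= rmorphD rmorphM scalerDl scalerDr -scalerA; congr pair.
      by rewrite addrACA.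
    by ring.
  - move=> _ [t [u [Gu ->]]] /=.
    have [t0|t0|->] := ltgtP t 0.
    + have nt : 0 < - t by rewrite oppr_gt0.
      have := cge _ (Gscal (- t)^-1 _ Gu); rewrite /= => h.
      have -> : u.1 + emb t *: v0 = emb (- t) *: (emb (- t)^-1 *: u.1 - v0).
        rewrite scalerBr scalerA -rmorphM mulfV ?gt_eqF// rmorph1 scale1r.
        by rewrite rmorphN scaleNr opprK.
      rewrite qZ ?(ltW nt)//; move: h; rewrite -(ler_pM2l nt); congr (_ <= _).
      by rewrite mulrBr mulrA mulfV ?gt_eqF// mul1r mulNr opprK.
    + have := cle _ (Gscal t^-1 _ Gu); rewrite /= => h.
      have -> : u.1 + emb t *: v0 = emb t *: (emb t^-1 *: u.1 + v0).
        by rewrite scalerDr scalerA -rmorphM mulfV ?gt_eqF// rmorph1 scale1r.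
      rewrite qZ ?(ltW t0)//; move: h; rewrite -(ler_pM2l t0); congr (_ <= _).
      by rewrite mulrDr mulrA mulfV ?gt_eqF// mul1r.
    + by rewrite rmorph0 scale0r mul0r !addr0; exact: dG.
(* Domination forces single values: two values [a], [b] at one vector put [(0, a - b)] in [G], and
   [q 0 = 0]. *)
have Gfun v r r' : G (v, r) -> G (v, r') -> r = r'.
  have le a b : G (v, a) -> G (v, b) -> a <= b.
    move=> Ga Gb; have := Gadd _ _ Ga (Gscal (-1) _ Gb).
    rewrite /= rmorphN rmorph1 scaleN1r subrr mulN1r => /dG/=.
    have := qZ 0 (lexx 0); rewrite mul0r.
    by rewrite scaler0 => ->; rewrite subr_le0.
  by move=> Ga Gb; apply/eqP; rewrite eq_le !le.
have /choice[phi phiG] := tot.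
exists phi; split.
- by move=> r x y; apply: Gfun (phiG _) _; exact: clG (phiG x) (phiG y).
- by move=> x; exact: dG (phiG x).
- by move=> [v r] /G0G Gu; exact: Gfun (phiG v) Gu.
Qed.
End RealHahnBanach.

Lemma hahn_banach_real (R : realType) (U V : lmodType R) (L : {linear U -> V})
    (f : {scalar U}) (p : V -> R) :
  (forall x y, p (x + y) <= p x + p y) ->
  (forall a x, p (a *: x) = `|a| * p x) ->
  (forall u, `|f u| <= p (L u)) ->
  exists g : V -> R, [/\ scalar g, forall u, g (L u) = f u &
    forall v, `|g v| <= p v].
Proof.
move=> pD pZ fp; pose G0 := [set (L u, f u) | u in [set: U]].
have [||||g [gl gp gG]] := @dominated_functional R R idfun V p pD _ G0.
- by move=> r x r0; rewrite pZ ger0_norm.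
- by exists 0 => //; rewrite !linear0.
- move=> r _ _ [u _ <-] [v _ <-] /=; exists (r *: u + v) => //.
  by rewrite !linearP.
- by move=> _ [u _ <-] /=; exact: le_trans (ler_norm _) (fp u).
have gN v : g (- v) = - g v.
  have g0 : g 0 = 0 by have := gl 1 0 0; rewrite scale1r mul1r addr0; lra.
  by have := gl (-1) v 0; rewrite scaleN1r mulN1r g0 !addr0.
have pN v : p (- v) = p v by rewrite -scaleN1r pZ normrN1 mul1r.
exists g; split => [a x y | u | v]; first exact: gl.
  by apply: (gG (_, _)); exists u.
by rewrite ler_norml gp lerNl -gN -(pN v) gp.
Qed.

(** A real functional [g] dominated by [p] extends the real part of [f]; the complex functional with
    real part [g] is g v - i g (i v). *)
Lemma hahn_banach_complex (R : realType) (U V : lmodType R[i])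
    (L : {linear U -> V}) (f : {scalar U}) (p : V -> R[i]) :
  (forall x, 0 <= p x) ->
  (forall x y, p (x + y) <= p x + p y) ->
  (forall a x, p (a *: x) = `|a| * p x) ->
  (forall u, `|f u| <= p (L u)) ->
  exists g : V -> R[i], [/\ scalar g, forall u, g (L u) = f u &
    forall v, `|g v| <= p v].
Proof.
move=> p0 pD pZ fp.
pose q v := complex.Re (p v).
have pE v : p v = (q v)%:C%C by rewrite RRe_real// ger0_real.
pose G0 := [set (L u, complex.Re (f u)) | u in [set: U]].
have ReM (r : R) (z : R[i]) : complex.Re (r%:C%C * z) = r * complex.Re z.
  by case: z => a b /=; rewrite mul0r subr0.
have Rele (z : R[i]) : (complex.Re z)%:C%C <= `|z|.
  apply: le_trans (normc_ge_Re z); rewrite lecR; exact: ler_norm.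
have [|||||g [gl gp gG]] :=
  @dominated_functional R R[i] (real_complex R) V q _ _ G0.
- by move=> x y; rewrite -lecR rmorphD/= -!pE; exact: pD.
- move=> r x r0; apply: complexI; rewrite rmorphM/= -!pE pZ.
  by rewrite ger0_norm // lecR.
- by exists 0 => //; rewrite !linear0.
- move=> r _ _ [u _ <-] [v _ <-] /=; exists (r%:C%C *: u + v) => //.
  by rewrite !linearP raddfD/= ReM.
- move=> _ [u _ <-] /=; rewrite -lecR -pE.
  exact: le_trans (Rele _) (fp u).
pose h v := (g v)%:C%C - 'i%C * (g ('i%C *: v))%:C%C.
have gD x y : g (x + y) = g x + g y by have := gl 1 x y; rewrite rmorph1 scale1r mul1r.
have g0 : g 0 = 0 by have := gD 0 0; rewrite addr0; lra.
have gZ r x : g (r%:C%C *: x) = r * g x by have := gl r x 0; rewrite g0 !addr0.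
have hD x y : h (x + y) = h x + h y.
  by rewrite /h scalerDr !gD !rmorphD /=; ring.
have hR r x : h (r%:C%C *: x) = r%:C%C * h x.
  by rewrite /h scalerA ['i%C * r%:C%C]mulrC -scalerA !gZ !rmorphM /=; ring.
have hi x : h ('i%C *: x) = 'i%C * h x.
  rewrite /h scalerA -expr2 sqr_i scaleN1r.
  have -> : - x = (-1)%:C%C *: x by rewrite rmorphN rmorph1 scaleN1r.
  rewrite gZ mulN1r rmorphN mulrN opprK mulrBr mulrA -expr2 sqr_i.
  by ring.
have hZ a x : h (a *: x) = a * h x.
  by rewrite (complexE a) scalerDl hD -scalerA hi !hR mulrDl !mulrA.
have Reh v : complex.Re (h v) = g v.
  by rewrite /h raddfB/= mul0r mulr0 !subr0.
exists h; split=> [a x y|u|v].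
- by rewrite hD hZ.
- have gL w : g (L w) = complex.Re (f w) by apply: (gG (_, _)); exists w.
  rewrite /h -linearZ !gL linearZ/= [RHS]complexE; congr (_ + _).
  by rewrite ['i%C * f u]mulrC ReiNIm rmorphN mulrN opprK.
- have [->|hv] := eqVneq (h v) 0; first by rewrite normr0.
  (* Rotating [v] by the sign [a] makes the value of [h] equal to its real part, which [p]
     bounds. *)
  pose a := `|h v| / h v.
  have a1 : `|a| = 1 by rewrite normrM normfV normr_id mulfV// normr_eq0.
  have : h (a *: v) = `|h v| by rewrite hZ divfK.
  move=> e; have := gp (a *: v); rewrite -lecR -pE pZ a1 mul1r -Reh e.
  by rewrite RRe_real// normr_real.
Qed.

(* L need not be injective: the bound by p (L u) makes f factor through it. *)
Lemma hahn_banach (R : realType) (s : scalar_kind)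
    (U V : lmodType (scalars R s)) (L : {linear U -> V})
    (f : {scalar U}) (p : V -> scalars R s) :
  (forall x, 0 <= p x) ->
  (forall x y, p (x + y) <= p x + p y) ->
  (forall a x, p (a *: x) = `|a| * p x) ->
  (forall u, `|f u| <= p (L u)) ->
  exists g : V -> scalars R s, [/\ scalar g, forall u, g (L u) = f u &
    forall v, `|g v| <= p v].
Proof.
case: s U V L f p => U V L f p p0 pD pZ fp.
  exact: hahn_banach_real pD pZ fp.
exact: hahn_banach_complex p0 pD pZ fp.
Qed.

(** * Unconditional bases and their coordinate functionals *)

Section DualFunctionals.
Variables (R : realType) (s : scalar_kind).
Notation K := (scalars R s).
Variable V : normedModType K.
Implicit Types (f g : dual V) (u v : V).

Lemma dual_subr f u v : f (u - v) = f u - f v.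
Proof. exact: linearB. Qed.

Lemma dual_scaler f (a : K) v : f (a *: v) = a * f v.
Proof. exact: linearZ. Qed.

Lemma dual_addr f u v : f (u + v) = f u + f v.
Proof. exact: linearD. Qed.

Lemma dual_subE f g v : (f - g) v = f v - g v.
Proof. by []. Qed.

Lemma dual_bound f v : `|f v| <= `|f| * `|v|.
Proof.
have [->|v0] := eqVneq v 0; first by rewrite linear0 !normr0 mulr0.
have nv : `|v| != 0 by rewrite normr_eq0.
have : `|f (`|v|^-1 *: v)| <= `|f|.
  by apply: dual_norm_ub; rewrite normrZ normfV normr_id mulVf.
rewrite linearZ/= normrM normfV normr_id.
by rewrite ler_pdivrMl ?normr_gt0// mulrC.
Qed.

Lemma dual_norm_leP f (C : K) : 0 <= C ->
  (forall v, `|f v| <= C * `|v|) -> `|f| <= C.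
Proof.
move=> C0 fC; apply: dual_norm_le => v v1.
by apply: le_trans (fC v) _; rewrite ler_piMr.
Qed.

Lemma bounded_functional_dual (g : V -> K) (C : K) : 0 <= C ->
  scalar g -> (forall v, `|g v| <= C * `|v|) ->
  exists f, forall v, f v = g v.
Proof.
move=> C0 gl gC.
pose gL := GRing.isLinear.Build K V K^o *:%R (g : V -> K^o) gl.
pose G : {linear V -> K^o} := HB.pack (g : V -> K^o) gL.
have cG : continuous G.
  apply/linear_bounded_continuous/linear_boundedP.
  near=> r => x; apply: le_trans (gC x) _; apply: ler_wpM2r => //.
  by near: r; apply: nbhs_pinfty_ge; exact: ger0_real.
have Gd : (g : V -> K^o) \in @dual_pred R s V by apply/asboolP; split.
by exists (Dual Gd).
Unshelve. all: by end_near.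
Qed.
End DualFunctionals.

Section C00Theory.
Variable K : numFieldType.
Implicit Types (x y : c00 K) (a : nat -> K).

Lemma c00_eqP x y : (forall i, x i = y i) -> x = y.
Proof. by move=> xy; apply/val_inj/funext. Qed.

Lemma c00_bound x : exists n, forall i, (n <= i)%N -> x i = 0.
Proof. by case: x => x /= /asboolP. Qed.

Lemma c00_sumE (I : Type) (r : seq I) (F : I -> c00 K) j :
  (\sum_(i <- r) F i) j = \sum_(i <- r) F i j.
Proof. by apply: (big_morph (fun x : c00 K => x j)). Qed.

Lemma c00_expand n x : (forall i, (n <= i)%N -> x i = 0) ->
  x = \sum_(i < n) x i *: c00_delta K i.
Proof.
move=> xn; apply: c00_eqP => j; rewrite c00_sumE.
have [jn|nj] := ltnP j n.
  rewrite (bigD1 (Ordinal jn))//= big1 => [|i ij].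
    by rewrite addr0; change (x j = x j * (j == j)%:R); rewrite eqxx mulr1.
  change (x i * (j == i)%:R = 0); rewrite (_ : (j == i) = false) ?mulr0//.
  by apply/negbTE; apply: contraNneq ij => ji; apply/eqP/val_inj.
rewrite xn// big1// => i _; change (x i * (j == i)%:R = 0).
by rewrite gtn_eqF ?mulr0// (leq_trans (ltn_ord i)).
Qed.

Lemma c00_mul_subproof a x : (fun i => a i * x i : K^o) \in @c00_pred K.
Proof.
have [n xn] := c00_bound x.
by apply/asboolP; exists n => i /xn ->; rewrite mulr0.
Qed.
Definition c00_mul a x := C00 (c00_mul_subproof a x).

Lemma c00_mul_linear a : linear (c00_mul a).
Proof.
move=> b x y; apply: c00_eqP => i.
by change (a i * (b * x i + y i) = b * (a i * x i) + a i * y i); ring.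
Qed.
HB.instance Definition _ a :=
  GRing.isLinear.Build K (c00 K) (c00 K) *:%R (c00_mul a) (c00_mul_linear a).

Lemma c00_support x : exists A : {fset nat}, forall i, (i \in A) = (x i != 0).
Proof.
have [n xn] := c00_bound x.
exists [fset i in seq.iota 0 n | x i != 0]%fset => i.
rewrite !inE/= mem_iota/= add0n andbC; case: eqVneq => //= xi.
by rewrite ltnNge; apply: contraNN xi => /xn ->.
Qed.

End C00Theory.

Section Frames.
Variables (R : realType) (s : scalar_kind).
Notation K := (scalars R s).
Variable V : normedModType K.

(* Both E and the spaces X are accessed through a linear map from c00 sending
   the j-th unit vector to the j-th basis vector. *)
Definition unconditional_frame (iota : {linear c00 K -> V}) : Prop :=
  [/\ dense (range iota),
      forall x y : c00 K, (forall i, `|x i| <= `|y i|) ->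
        `|iota x| <= `|iota y|
    & forall i, `|iota (c00_delta K i)| = 1].

Variable iota : {linear c00 K -> V}.
Local Notation e i := (iota (c00_delta K i)).

Lemma functional_c00 (W : lmodType K) (L : {linear c00 K -> W}) n (x : c00 K) :
  (forall i, (n <= i)%N -> x i = 0) ->
  L x = \sum_(i < n) x i *: L (c00_delta K i).
Proof.
move=> xn; rewrite {1}(c00_expand xn) linear_sum.
by apply: eq_bigr => i _; rewrite linearZ.
Qed.

Hypothesis frm : unconditional_frame iota.
Implicit Types (f g : dual V) (x y : c00 K).

Lemma frame_approx (v : V) (eps : K) : 0 < eps ->
  exists x, `|v - iota x| < eps.
Proof.
move=> eps0; have [d _ _] := frm.
have [||w [vw [x _ xw]]] := d (ball v eps).
- by exists v; exact: ballxx.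
- exact: ball_open.
- by exists x; rewrite xw; move: vw; rewrite -ball_normE.
Qed.

Lemma dual_c00_norm_le f (C : K) : 0 <= C ->
  (forall x, `|f (iota x)| <= C * `|iota x|) -> `|f| <= C.
Proof.
move=> C0 fC; apply: dual_norm_leP => // v.
apply/ler_addgt0Pr => eps eps0.
have M0 : 0 < `|f| + C + 1 by rewrite ltr_pwDr// addr_ge0.
have [x vx] := frame_approx v (divr_gt0 eps0 M0).
have -> : f v = f (v - iota x) + f (iota x) by rewrite -linearD subrK.
apply: le_trans (ler_normD _ _) _.
apply: le_trans (lerD (dual_bound _ _) (fC x)) _.
have : `|iota x| <= `|v| + `|v - iota x|.
  by rewrite -{1}(subrK v (iota x)) addrC distrC (le_trans (ler_normD _ _))// .
move=> /(ler_wpM2l C0); rewrite mulrDr => h.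
apply: le_trans (lerD (lexx _) h) _.
rewrite addrCA lerD2l -mulrDl.
apply: le_trans (_ : (`|f| + C + 1) * `|v - iota x| <= _).
  by rewrite ler_wpM2r// lerDl.
by rewrite mulrC -ler_pdivlMr// ltW.
Qed.

Lemma dual_c00_ext f g :
  (forall i, f (e i) = g (e i)) -> f = g.
Proof.
move=> fg; apply/eqP; rewrite -subr_eq0 -normr_le0.
apply: dual_c00_norm_le => // x; rewrite mul0r normr_le0.
have [n xn] := c00_bound x.
rewrite (functional_c00 iota xn) linear_sum big1// => i _.
rewrite linearZ/=; change (x i * (f (e i) - g (e i)) = 0).
by rewrite fg subrr mulr0.
Qed.

(** Coordinate functionals, multipliers, lifts and pieces of splittings are all obtained in this way
    from their values on [c00]. *)
Lemma dual_c00_extension (phi : {scalar c00 K}) (C : K) : 0 <= C ->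
  (forall x, `|phi x| <= C * `|iota x|) ->
  exists f : dual V, (forall x, f (iota x) = phi x) /\ `|f| <= C.
Proof.
move=> C0 phiC.
have [|||//|g [gl gphi gC]] := @hahn_banach R s _ _ iota phi (fun v => C * `|v|).
- by move=> v; rewrite mulr_ge0.
- by move=> u v; rewrite -mulrDr ler_wpM2l// ler_normD.
- by move=> a v; rewrite normrZ mulrCA.
have [f fg] := bounded_functional_dual C0 gl gC.
exists f; split=> [x|]; first by rewrite fg gphi.
by apply: dual_norm_leP => // v; rewrite fg.
Qed.

Lemma frame_delta_norm i : `|e i| = 1.
Proof. by have [_ _] := frm. Qed.

Lemma frame_unc x y : (forall i, `|x i| <= `|y i|) -> `|iota x| <= `|iota y|.
Proof. by have [_ + _] := frm; apply. Qed.

Lemma dual_multiplier f (a : nat -> K) : (forall i, `|a i| <= 1) ->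
  exists g, (forall i, g (e i) = a i * f (e i)) /\ `|g| <= `|f|.
Proof.
move=> a1.
have phil : scalar (fun x : c00 K => f (iota (c00_mul a x)) : K).
  by move=> b x y; rewrite !linearP.
pose phiL := GRing.isLinear.Build K (c00 K) K *%R
  (fun x : c00 K => f (iota (c00_mul a x)) : K) phil.
pose phi : {scalar c00 K} := HB.pack
  (fun x : c00 K => f (iota (c00_mul a x)) : K) phiL.
have [//||g [gphi gf]] := @dual_c00_extension phi `|f|.
  move=> x; apply: le_trans (dual_bound _ _) _; apply: ler_wpM2l => //.
  apply: frame_unc => i; change (`|a i * x i| <= `|x i|).
  by rewrite normrM ler_piMl.
exists g; split=> // i; rewrite gphi; change (f (iota (c00_mul a (c00_delta K i))) = a i * f (e i)).
have -> : c00_mul a (c00_delta K i) = a i *: c00_delta K i.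
  apply: c00_eqP => j; change (a j * (j == i)%:R = a i * (j == i)%:R).
  by case: eqVneq => [->//|]; rewrite !mulr0.
by rewrite !linearZ.
Qed.

(** The dual norm inherits unconditionality: [f] is [g] multiplied by the quotients
    [f (e i) / g (e i)], where 0 / 0 = 0. *)
Lemma dual_unc f g : (forall i, `|f (e i)| <= `|g (e i)|) -> `|f| <= `|g|.
Proof.
move=> fg; pose a i := f (e i) / g (e i).
have [i|h [hg hn]] := @dual_multiplier g a.
  have [g0|g0] := eqVneq (g (e i)) 0; first by rewrite /a g0 invr0 mulr0 normr0.
  by rewrite normrM normfV ler_pdivrMr ?normr_gt0// mul1r.
suff -> : f = h by [].
apply: dual_c00_ext => i; rewrite hg /a.
have [g0|g0] := eqVneq (g (e i)) 0; last by rewrite divfK.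
have := fg i; rewrite g0 normr0 normr_le0 => /eqP ->.
by rewrite !mul0r.
Qed.
End Frames.

Section CoordinateFunctionals.
Variables (R : realType) (s : scalar_kind).
Notation K := (scalars R s).
Variables (V : normedModType K) (iota : {linear c00 K -> V}).
Hypothesis frm : unconditional_frame iota.
Local Notation e i := (iota (c00_delta K i)).
Local Notation ec := (coordf (fun j => iota (c00_delta K j))).
Implicit Types (f g : dual V) (x y : c00 K).

Lemma frame_coord_le x i : `|x i| <= `|iota x|.
Proof.
rewrite -[leLHS]mulr1 -(frame_delta_norm frm i) -normrZ -linearZ.
apply: (frame_unc frm) => j; change (`|x i * (j == i)%:R| <= `|x j|).
by case: eqVneq => [->|]; rewrite ?mulr1// mulr0 normr0.
Qed.

Lemma series_functional f (a : nat -> K) (v : V) (c : K) N :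
  series (fun k => a k *: e k) @ \oo --> v ->
  (forall n, (N <= n)%N -> \sum_(i < n) a i * f (e i) = c) -> f v = c.
Proof.
move=> av fc.
have h1 : f \o series (fun k => a k *: e k) @ \oo --> f v.
  by apply: cvg_comp av _; exact: dual_continuous.
have h2 : f \o series (fun k => a k *: e k) @ \oo --> (c : K^o).
  apply: cvg_near_cst; exists N => // n /= Nn.
  rewrite /series/= big_mkord linear_sum -(fc n Nn).
  by apply: eq_bigr => i _; rewrite linearZ.
exact: (cvg_unique (@norm_hausdorff _ _) h1 h2).
Qed.

Lemma coordf_spec i : [/\ forall j, ec i (e j) = (j == i)%:R & `|ec i| <= 1].
Proof.
have phil : scalar (fun x : c00 K => x i : K) by [].
pose phiL := GRing.isLinear.Build K (c00 K) K *%R (fun x : c00 K => x i : K) phil.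
pose phi : {scalar c00 K} := HB.pack (fun x : c00 K => x i : K) phiL.
have [//||f [fphi f1]] := dual_c00_extension (iota := iota) (phi := phi) (C := 1).
  by move=> x; rewrite mul1r; exact: frame_coord_le.
have fe j : f (e j) = (j == i)%:R by rewrite fphi/= eq_sym.
(* [coordf] is chosen among the functionals reading off the coefficients of every convergent series;
   [f] is one of them, so the default value is not taken. *)
have spec : (forall (a : nat -> K) (v : V),
    series (fun k => a k *: e k) @ \oo --> v -> ec i v = a i).
  rewrite /coordf; case: xgetP => [g _ //|/(_ f) []].
  move=> a v av; apply: (series_functional (N := i.+1) av) => n ni.
  rewrite (bigD1 (Ordinal ni))//= fe eqxx mulr1 big1 ?addr0// => j ji.
  rewrite fe (_ : (j == i :> nat) = false) ?mulr0//.
  by apply/negbTE; apply: contraNneq ji => ji; apply/eqP/val_inj.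
have ce j : ec i (e j) = (j == i)%:R.
  rewrite (spec (fun k => (k == j)%:R)) 1?eq_sym//.
  apply: cvg_near_cst; exists j.+1 => // n /= jn.
  rewrite /series/= big_mkord (bigD1 (Ordinal jn))//= eqxx scale1r.
  rewrite big1 ?addr0// => k kj.
  rewrite (_ : (k == j :> nat) = false) ?scale0r//.
  by apply/negbTE; apply: contraNneq kj => kj; apply/eqP/val_inj.
split=> //; suff -> : ec i = f by [].
by apply: (dual_c00_ext frm) => j; rewrite ce fe.
Qed.

Lemma coordfE i j : ec i (e j) = (j == i)%:R.
Proof. by have [] := coordf_spec i. Qed.

Lemma coordf_norm i : `|ec i| = 1.
Proof.
apply/eqP; rewrite eq_le; have [_ ->/=] := coordf_spec i.
have := dual_bound (ec i) (e i).
by rewrite coordfE eqxx (frame_delta_norm frm) normr1 mulr1.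
Qed.

Lemma dual_sumE (I : Type) (r : seq I) (P : pred I) (F : I -> dual V) v :
  (\sum_(i <- r | P i) F i) v = \sum_(i <- r | P i) F i v.
Proof. by apply: (big_morph (fun f : dual V => f v)). Qed.

Definition coord_sum (A : {fset nat}) (a : nat -> K) : dual V :=
  \sum_(i <- A) a i *: ec i.

Lemma coord_sumE (A : {fset nat}) (a : nat -> K) j :
  coord_sum A a (e j) = if j \in A then a j else 0.
Proof.
have E i : (a i *: ec i) (e j) = a i * (j == i)%:R by rewrite dual_scaleE coordfE.
rewrite dual_sumE (eq_bigr _ (fun i _ => E i)); case: ifP => jA.
  rewrite (bigD1_seq j) ?fset_uniq//= eqxx mulr1 big1 ?addr0// => i ij.
  by rewrite eq_sym (negbTE ij) mulr0.
rewrite big_seq big1// => i iA.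
by case: eqVneq iA => [<-|]; rewrite ?jA ?mulr0.
Qed.

Definition dual_trunc n f : dual V := coord_sum [fset i in seq.iota 0 n]%fset (fun i => f (e i)).

Lemma dual_truncE n f j : dual_trunc n f (e j) = if (j < n)%N then f (e j) else 0.
Proof. by rewrite coord_sumE !inE/= mem_iota. Qed.

Lemma dual_trunc_norm n f : `|dual_trunc n f| <= `|f|.
Proof.
apply: (dual_unc frm) => i; rewrite dual_truncE.
by case: ifP => // _; rewrite normr0.
Qed.

Lemma dual_truncD n f g : dual_trunc n (f + g) = dual_trunc n f + dual_trunc n g.
Proof.
apply: (dual_c00_ext frm) => i; rewrite dual_addE !dual_truncE dual_addE.
by case: ifP => // _; rewrite addr0.
Qed.

Lemma dual_trunc_id n f : (forall i, (n <= i)%N -> f (e i) = 0) -> dual_trunc n f = f.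
Proof.
move=> fn; apply: (dual_c00_ext frm) => i; rewrite dual_truncE.
by case: ltnP => // /fn ->.
Qed.

(** Convergence in the w*-topology: the truncations are bounded in norm and agree with [f] on each
    finitely supported vector from some rank on. *)
Lemma dual_trunc_cvg f v : (fun n => dual_trunc n f v) @ \oo --> f v.
Proof.
apply/cvgrPdist_le => eps eps0.
have M0 : 0 < `|f| + `|f| + 1 by rewrite ltr_pwDr// addr_ge0.
have [x vx] := frame_approx frm v (divr_gt0 eps0 M0).
have [N xN] := c00_bound x.
exists N => // n /= Nn.
have -> : f v - dual_trunc n f v = (f - dual_trunc n f) (v - iota x).
  rewrite dual_subr.
  suff -> : (f - dual_trunc n f) (iota x) = 0 by rewrite subr0.
  rewrite (functional_c00 _ xN) linear_sum big1// => i _.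
  rewrite linearZ/=; change (x i * (f (e i) - dual_trunc n f (e i)) = 0).
  by rewrite dual_truncE (leq_trans (ltn_ord i) Nn) subrr mulr0.
apply: le_trans (dual_bound _ _) _.
apply: le_trans (_ : (`|f| + `|f| + 1) * `|v - iota x| <= _); last first.
  by rewrite mulrC -ler_pdivlMr// ltW.
apply: ler_wpM2r => //; apply: le_trans (ler_normB _ _) _.
by rewrite -addrA lerD2l (le_trans (dual_trunc_norm _ _))// lerDl.
Qed.

Lemma coord_span_bounded f : linear_span (range ec) f ->
  exists n, forall i, (n <= i)%N -> f (e i) = 0.
Proof.
move=> [n [a [u [uc ->]]]].
have /choice[k kE] i : exists k, ec k = u i by have [k _ <-] := uc i; exists k.
exists (\max_(i < n) (k i).+1)%N => j jn.
rewrite dual_sumE big1// => i _; rewrite dual_scaleE -kE coordfE.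
by rewrite gtn_eqF ?mulr0// (leq_trans _ jn)// (leq_bigmax i).
Qed.

Lemma bounded_coord_span f n : (forall i, (n <= i)%N -> f (e i) = 0) ->
  linear_span (range ec) f.
Proof.
move=> fn; exists n, (fun i => f (e i)), (fun i => ec i); split=> [i|].
  by exists (i : nat).
apply: (dual_c00_ext frm) => j; rewrite dual_sumE.
have E i : (f (e i) *: ec i) (e j) = f (e i) * (j == i)%:R by rewrite dual_scaleE coordfE.
rewrite (eq_bigr _ (fun (i : 'I_n) _ => E i)); have [jn|nj] := ltnP j n.
  rewrite (bigD1 (Ordinal jn))//= eqxx mulr1 big1 ?addr0// => i ij.
  rewrite (_ : (j == i) = false) ?mulr0//.
  by apply/negbTE; apply: contraNneq ij => ji; apply/eqP/val_inj.
by rewrite fn// big1// => i _; rewrite gtn_eqF ?mulr0// (leq_trans (ltn_ord i)).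
Qed.

(** If [h] in the span approximates [f], truncation fixes [h] from some rank on, and the remainder
    of [f - h] has at most twice its norm. *)
Lemma dual_trunc_cvg_norm f : coordf_closed_span (fun j => e j) f ->
  (fun n => dual_trunc n f) @ \oo --> f.
Proof.
move=> fZ; apply/cvgrPdist_le => eps eps0.
have eps2 : 0 < eps / 2 by rewrite divr_gt0.
have [h [hs hb]] := fZ _ (nbhsx_ballx f (eps / 2) eps2).
have [N hN] := coord_span_bounded hs.
exists N => // n /= Nn.
have {}hb : `|f - h| < eps / 2 by move: hb; rewrite -ball_normE.
have -> : f - dual_trunc n f = (f - h) - dual_trunc n (f - h).
  have -> : dual_trunc n f = dual_trunc n (f - h) + h.
    have e1 : dual_trunc n h = h.
      by apply: dual_trunc_id => i ni; apply: hN; exact: leq_trans Nn ni.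
    by rewrite -[X in _ = _ + X]e1 -dual_truncD subrK.
  by rewrite opprD addrA addrAC.
apply: le_trans (ler_normB _ _) _; rewrite (splitr eps).
apply: lerD; first exact: ltW.
exact: le_trans (dual_trunc_norm _ _) (ltW hb).
Qed.
End CoordinateFunctionals.

(** * Combinatorial spaces *)

Section BasisFrame.
Variables (R : realType) (s : scalar_kind).
Notation K := (scalars R s).
Variables (E : normedModType K) (ee : nat -> E).

Lemma basis_frame : normalized_unconditional_basis ee ->
  exists iota : {linear c00 K -> E},
    unconditional_frame iota /\ forall i, iota (c00_delta K i) = ee i.
Proof.
move=> [sch nrm unc].
have /choice[b bP] := @c00_bound K.
pose L (x : c00 K) := \sum_(i < b x) x i *: ee i.
have LE n (x : c00 K) : (forall i, (n <= i)%N -> x i = 0) -> L x = \sum_(i < n) x i *: ee i.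
  move=> xn; rewrite /L.
  have widen m : (m <= maxn (b x) n)%N -> (forall i, (m <= i)%N -> x i = 0) ->
      \sum_(i < m) x i *: ee i = \sum_(i < maxn (b x) n) x i *: ee i.
    move=> mM xm; rewrite (big_ord_widen _ (fun i => x i *: ee i) mM).
    rewrite big_mkcond; apply: eq_bigr => i _.
    by case: ltnP => // /xm ->; rewrite scale0r.
  by rewrite (widen (b x)) ?leq_maxl// ?(widen n) ?leq_maxr//; exact: bP.
have Ll : linear L.
  move=> a x y; pose n := maxn (b x) (b y).
  have xn i : (n <= i)%N -> x i = 0.
    by move=> ni; apply: bP; exact: leq_trans (leq_maxl _ _) ni.
  have yn i : (n <= i)%N -> y i = 0.
    by move=> ni; apply: bP; exact: leq_trans (leq_maxr _ _) ni.
  have xyn i : (n <= i)%N -> (a *: x + y) i = 0.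
    by move=> ni; change (a * x i + y i = 0); rewrite xn// yn// mulr0 addr0.
  rewrite (LE _ _ xn) (LE _ _ yn) (LE _ _ xyn) scaler_sumr -big_split.
  apply: eq_bigr => i _ /=; change ((a * x i + y i) *: ee i = a *: (x i *: ee i) + y i *: ee i).
  by rewrite scalerDl scalerA.
pose LL := GRing.isLinear.Build K (c00 K) E *:%R L Ll.
have [iota iotaL] : exists iota : {linear c00 K -> E}, forall x, iota x = L x.
  by exists (HB.pack L LL : {linear c00 K -> E}).
have iotaE i : iota (c00_delta K i) = ee i.
  have Li : iota (c00_delta K i) = \sum_(j < i.+1) c00_delta K i j *: ee j.
    by rewrite iotaL; apply: (LE) => j ij; change ((j == i)%:R = 0 :> K); rewrite gtn_eqF.
  rewrite Li big_ord_recr/= big1 => [|j _].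
    by rewrite add0r; change ((i == i)%:R *: ee i = ee i); rewrite eqxx scale1r.
  by change ((j == i :> nat)%:R *: ee j = 0); rewrite ltn_eqF// scale0r.
exists iota; split=> //; split.
- move=> O [v Ov] Oo; have [a [av _]] := sch v.
  have [N _ NO] := av _ (open_nbhs_nbhs (conj Oo Ov)).
  exists (series (fun i => a i *: ee i) N); split; first exact: NO N (leqnn N).
  exists (\sum_(i < N) a i *: c00_delta K i) => //.
  rewrite linear_sum /series/= big_mkord.
  by apply: eq_bigr => i _; rewrite linearZ/= iotaE.
- move=> x y xy; pose n := maxn (b x) (b y).
  have xn i : (n <= i)%N -> x i = 0.
    by move=> ni; apply: bP; exact: leq_trans (leq_maxl _ _) ni.
  have yn i : (n <= i)%N -> y i = 0.
    by move=> ni; apply: bP; exact: leq_trans (leq_maxr _ _) ni.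
  rewrite !iotaL (LE _ _ xn) (LE _ _ yn).
  exact: unc.
- by move=> i; rewrite iotaE.
Qed.
End BasisFrame.

Definition c00_restr (K : numFieldType) (P : pred nat) (x : c00 K) : c00 K :=
  c00_mul (fun i => (P i)%:R) x.

Section CombFrame.
Variables (R : realType) (s : scalar_kind).
Notation K := (scalars R s).
Variables (E : normedModType K) (iotaE : {linear c00 K -> E}).
Hypothesis frmE : unconditional_frame iotaE.
Variables (F : set {fset nat}).
Hypothesis combF : combinatorial_family F.

Lemma c00_restr_le (P : pred nat) (x : c00 K) i : `|c00_restr P x i| <= `|x i|.
Proof.
change (`|(P i)%:R * x i| <= `|x i|).
by case: (P i); rewrite ?mul1r// mul0r normr0.
Qed.

Lemma c00_restr_fset (A : {fset nat}) (x : c00 K) :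
  c00_restr (mem A) x = \sum_(i <- A) x i *: c00_delta K i.
Proof.
apply: c00_eqP => j; rewrite c00_sumE.
change ((j \in A)%:R * x j = \sum_(i <- A) x i * (j == i)%:R).
case: (boolP (j \in A)) => jA.
  rewrite (bigD1_seq j) ?fset_uniq//= eqxx mulr1 big1 ?addr0 ?mul1r// => i ij.
  by rewrite eq_sym (negbTE ij) mulr0.
rewrite mul0r big_seq big1// => i iA.
by case: eqVneq iA => [<-|]; rewrite ?(negbTE jA) ?mulr0.
Qed.

(** The last two clauses characterize the norm as a least upper bound over [F], so that [supremum]
    with its default value does not occur afterwards. *)
Definition comb_frame (X : normedModType K) (iota : {linear c00 K -> X}) :=
  [/\ unconditional_frame iota,
      forall x A, F A -> `|iotaE (c00_restr (mem A) x)| <= `|iota x|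
    & forall x (C : K),
      (forall A, F A -> `|iotaE (c00_restr (mem A) x)| <= C) -> `|iota x| <= C].

Lemma comb_space_frame (X : completeNormedModType K) (iota : {linear c00 K -> X}) :
  is_comb_space F (fun i => iotaE (c00_delta K i)) iota -> comb_frame iota.
Proof.
move=> [nrm dns].
have rE (x : c00 K) (A : {fset nat}) : \sum_(i <- A) x i *: iotaE (c00_delta K i) = iotaE (c00_restr (mem A) x).
  by rewrite c00_restr_fset linear_sum; apply: eq_bigr => i _; rewrite linearZ.
have lub x : isLub [set `|iotaE (c00_restr (mem A) x)| | A in F] `|iota x|.
  rewrite nrm /comb_norm.
  rewrite (_ : [set _ | A in F] = [set `|iotaE (c00_restr (mem A) x)| | A in F]);
    last by apply: eq_imagel => A _; rewrite rE.
  set A := (X in isLub X _).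
  have A0 : A !=set0.
    have [F1 _] := combF; eexists; exists [fset 0%N]%fset => //; exact: F1.
  have uA : ubound A !=set0.
    exists `|iotaE x| => _ [B _ <-]; apply: (frame_unc frmE) => i.
    exact: c00_restr_le.
  have [|z zA] := scalars_supremums_neq0 A0 _ uA; first by move=> _ [B _ <-].
  rewrite /supremum ifF; last by apply/negbTE/set0P.
  by case: xgetP => [y _ []//|/(_ z)/(_ zA)].
have ub x A : F A -> `|iotaE (c00_restr (mem A) x)| <= `|iota x|.
  by move=> FA; apply: (lub x).1; exists A.
have le x (C : K) : (forall A, F A -> `|iotaE (c00_restr (mem A) x)| <= C) -> `|iota x| <= C.
  by move=> xC; apply: (lub x).2 => _ [A FA <-]; exact: xC.
split=> //; split=> //.
- move=> x y xy; apply: le => A FA; apply: le_trans (ub y A FA).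
  apply: (frame_unc frmE) => i.
  change (`|(i \in A)%:R * x i| <= `|(i \in A)%:R * y i|).
  by rewrite !normrM ler_wpM2l.
- move=> i; apply/eqP; rewrite eq_le; apply/andP; split.
    apply: le => A FA; rewrite -(frame_delta_norm frmE i).
    by apply: (frame_unc frmE) => j; exact: c00_restr_le.
  rewrite -(frame_delta_norm frmE i).
  have Fi : F [fset i]%fset by have [+ _] := combF; apply.
  rewrite (le_trans _ (ub _ _ Fi))// le_eqVlt; apply/orP; left; apply/eqP.
  congr `|iotaE _|; apply: c00_eqP => j.
  change ((j == i)%:R = (j \in [fset i]%fset)%:R * (j == i)%:R :> K).
  by rewrite inE; case: (j == i); rewrite ?mulr1 ?mulr0.
Qed.
End CombFrame.

Section FrameApprox.
Variables (R : realType) (s : scalar_kind).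
Notation K := (scalars R s).
Variables (V : normedModType K) (iota : {linear c00 K -> V}).
Hypothesis frm : unconditional_frame iota.

(** The order of [K] is partial in the complex case; a sign applied to a nearly norming vector makes
    the value of [h] itself comparable with its norm. *)
Lemma dual_norm_approx (h : dual V) (eps : K) : 0 < eps ->
  exists x, [/\ `|iota x| <= 1, 0 <= h (iota x) & `|h| <= h (iota x) + eps].
Proof.
move=> eps0; have [he|eh] := real_leP (ger0_real (normr_ge0 h)) (ger0_real (ltW eps0)).
  by exists 0; rewrite !linear0 normr0 add0r.
suff [x [x1 hx]] : exists x, `|iota x| <= 1 /\ `|h| <= `|h (iota x)| + eps.
  have [h0|h0] := eqVneq (h (iota x)) 0.
    by exists x; rewrite h0 lexx; split=> //; move: hx; rewrite h0 normr0.
  exists ((`|h (iota x)| / h (iota x)) *: x); split.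
  - by rewrite linearZ normrZ normrM normfV normr_id mulfV ?normr_eq0// mul1r.
  - by rewrite linearZ dual_scaler divfK.
  - by rewrite linearZ dual_scaler divfK.
apply: contrapT => nex.
have hx x : `|iota x| <= 1 -> `|h (iota x)| <= `|h| - eps.
  move=> x1; have [//|lt] := real_leP (normr_real (h (iota x)))
    (realB (normr_real h) (ger0_real (ltW eps0))).
  by exfalso; apply: nex; exists x; split=> //; rewrite -lerBlDr ltW.
have C0 : 0 <= `|h| - eps by rewrite subr_ge0 ltW.
have : `|h| <= `|h| - eps.
  apply: (dual_c00_norm_le frm C0) => x.
  have [x0|x0] := eqVneq (iota x) 0; first by rewrite x0 linear0 !normr0 mulr0.
  have nx : `|iota x| != 0 by rewrite normr_eq0.
  have := hx (`|iota x|^-1 *: x); rewrite linearZ normrZ normfV normr_id mulVf//.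
  move=> /(_ (lexx _)); rewrite dual_scaler normrM normfV normr_id.
  by rewrite ler_pdivrMl ?normr_gt0// mulrC.
by rewrite lerBrDr gerDl => /(lt_le_trans eps0); rewrite ltxx.
Qed.

End FrameApprox.

(** * Norm-additive splittings of functionals *)

Section Decomposition.
Variables (R : realType) (s : scalar_kind).
Notation K := (scalars R s).
Variables (E : normedModType K) (iotaE : {linear c00 K -> E}).
Variables (F : set {fset nat}) (combF : combinatorial_family F).
Variables (X : normedModType K) (iota : {linear c00 K -> X}).
Hypothesis frmE : unconditional_frame iotaE.
Hypothesis cfX : comb_frame iotaE F iota.
Local Notation e i := (iota (c00_delta K i)).
Local Notation eE i := (iotaE (c00_delta K i)).
Let frm : unconditional_frame iota. Proof. by have [] := cfX. Qed.

Lemma max_norm_exists (W : normedModType K) (A : seq nat) (v : nat -> W) :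
  exists M : K, [/\ 0 <= M, forall m, m \in A -> `|v m| <= M &
    M = 0 \/ exists2 m, m \in A & M = `|v m|].
Proof.
elim: A => [|k A [M [M0 AM MA]]]; first by exists 0; split=> //; left.
have [kM|Mk] := real_leP (ger0_real (normr_ge0 (v k))) (ger0_real M0).
  exists M; split=> // [m|]; first by rewrite inE => /orP[/eqP->//|/AM].
  by case: MA => [|[m mA ->]]; [left|right; exists m => //; rewrite inE mA orbT].
exists `|v k|; split=> // [m|].
  by rewrite inE => /orP[/eqP->//|/AM mM]; exact: le_trans mM (ltW Mk).
by right; exists k => //; rewrite inE eqxx.
Qed.

(* The restrictions missing one point of G embed X in a finite sup-normed sum of
   copies of itself; a Hahn-Banach extension of g to that sum is the splitting. *)
Lemma dual_decomposition (G : {fset nat}) (g : dual X) : ~ F G ->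
  exists h : nat -> dual X,
    [/\ g = \sum_(m <- G) h m, forall m, m \in G -> h m (e m) = 0 &
        \sum_(m <- G) `|h m| <= `|g|].
Proof.
move=> nFG.
have [_ ubX leX] := cfX.
pose r m (x : c00 K) : c00 K := c00_restr (predC1 m) x.
have rl m a x y : r m (a *: x + y) = a *: r m x + r m y by exact: linearP.
have r_le m x : `|iota (r m x)| <= `|iota x|.
  by apply: (frame_unc frm) => i; exact: c00_restr_le.
have /choice[p pP] := @max_norm_exists X G.
have p0 v : 0 <= p v by have [] := pP v.
have pub v m : m \in G -> `|v m| <= p v by have [_ + _] := pP v; apply.
have pex v : p v = 0 \/ exists2 m, m \in G & p v = `|v m| by have [] := pP v.
have ple v C : 0 <= C -> (forall m, m \in G -> `|v m| <= C) -> p v <= C.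
  by move=> C0 vC; case: (pex v) => [->//|[m mG ->]]; exact: vC.
pose dg m (w : X) : nat -> X := fun k => if k == m then w else 0.
have sumE (w : nat -> X) k : (\sum_(m <- G) dg m (w m)) k = if k \in G then w k else 0.
  rewrite fct_sumE; case: ifP => kG.
    rewrite (bigD1_seq k) ?fset_uniq//= /dg eqxx big1 ?addr0// => i ik.
    by rewrite eq_sym (negbTE ik).
  rewrite big_seq big1// => i iG; rewrite /dg.
  by case: eqVneq iG => [<-|//]; rewrite kG.
have dgl m a (u w : X) : dg m (a *: u + w) = a *: dg m u + dg m w.
  apply/funext => k; change (dg m (a *: u + w) k = a *: dg m u k + dg m w k).
  by rewrite /dg; case: ifP => //; rewrite scaler0 addr0.
pose L (x : c00 K) := \sum_(m <- G) dg m (iota (r m x)).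
have Ll : linear L.
  move=> a x y; rewrite /L scaler_sumr -big_split.
  by apply: eq_bigr => m _; rewrite rl linearP dgl.
have [LL LLE] : exists LL : {linear c00 K -> (nat -> X)}, forall x, LL x = L x.
  pose Lm := GRing.isLinear.Build K (c00 K) (nat -> X) *:%R L Ll.
  by exists (HB.pack L Lm : {linear c00 K -> (nat -> X)}).
have gl : scalar (fun x : c00 K => g (iota x) : K).
  by move=> a x y; rewrite !linearP.
have [f fE] : exists f : {scalar c00 K}, forall x, f x = g (iota x).
  pose fm := GRing.isLinear.Build K (c00 K) K *%R
    (fun x : c00 K => g (iota x) : K) gl.
  by exists (HB.pack (fun x : c00 K => g (iota x) : K) fm : {scalar c00 K}).
(* A member [A] of [F] misses some [m] in [G], for otherwise [G] would be in [F]; dropping the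
   coordinate [m] does not change the restriction to [A]. *)
have normL x : `|iota x| <= p (L x).
  apply: leX => A FA.
  have [m mG mA] : exists2 m, m \in G & m \notin A.
    apply: contrapT => nm; apply: nFG; apply: combF.2 FA.
    apply/fsubsetP => m mG; apply: contrapT => /negP mA.
    by apply: nm; exists m.
  apply: le_trans (pub (L x) m mG).
  rewrite /L (sumE (fun m => iota (r m x))) mG.
  apply: le_trans (ubX _ A FA).
  apply: (frame_unc frmE) => i.
  change (`|(i \in A)%:R * x i| <= `|(i \in A)%:R * ((i != m)%:R * x i)|).
  case: eqVneq => [->|]; last by rewrite mul1r.
  by rewrite (negbTE mA) !mul0r.
have [|||x|H [Hl Hf HC]] := @hahn_banach R s _ _ LL f (fun v => `|g| * p v).
- by move=> v; rewrite mulr_ge0.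
- move=> u v; rewrite -mulrDr ler_wpM2l//; apply: ple.
    by rewrite addr_ge0.
  by move=> m mG; apply: le_trans (ler_normD _ _) _; rewrite lerD ?pub.
- move=> a v; rewrite mulrCA; congr (_ * _); apply/eqP; rewrite eq_le.
  apply/andP; split.
    apply: ple => [|m mG]; first by rewrite mulr_ge0.
    by rewrite normrZ ler_wpM2l ?pub.
  case: (pex v) => [->|[m mG ->]]; first by rewrite mulr0.
  by rewrite -normrZ; exact: (pub (a *: v)).
- rewrite fE LLE; apply: le_trans (dual_bound _ _) _.
  by rewrite ler_wpM2l.
have H0 : H 0 = 0.
  by have := Hl 1 0 0; rewrite scale1r mul1r addr0 -[LHS]addr0 => /addrI.
have HD u v : H (u + v) = H u + H v by have := Hl 1 u v; rewrite scale1r mul1r.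
have Hsum (I : Type) (t : seq I) (w : I -> nat -> X) :
    H (\sum_(i <- t) w i) = \sum_(i <- t) H (w i).
  exact: (big_morph H HD H0).
have phiP m : exists h : dual X, forall x, h (iota x) = H (dg m (iota (r m x))).
  have phil : scalar (fun x : c00 K => H (dg m (iota (r m x)))).
    by move=> a x y; rewrite rl linearP dgl Hl.
  pose phim := GRing.isLinear.Build K (c00 K) K *%R _ phil.
  pose phi : {scalar c00 K} :=
    HB.pack (fun x : c00 K => H (dg m (iota (r m x)))) phim.
  have [//||h [hE _]] := dual_c00_extension (iota := iota) (phi := phi) (C := `|g|).
    move=> x; apply: le_trans (HC _) _; rewrite ler_wpM2l//.
    apply: ple => // k kG; rewrite /dg; case: ifP => _; last by rewrite normr0.
    exact: r_le.
  by exists h.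
have /choice[h hE] := phiP.
exists h; split.
- apply: (dual_c00_ext frm) => i; rewrite -fE -Hf LLE Hsum dual_sumE.
  by apply: eq_bigr => m _; rewrite hE.
- move=> m mG; rewrite hE (_ : r m _ = 0).
    rewrite linear0 (_ : dg m 0 = 0) ?H0//.
    by apply/funext => k; rewrite /dg; case: ifP.
  apply: c00_eqP => i; change ((i != m)%:R * (i == m)%:R = 0 :> K).
  by case: eqVneq; rewrite ?mul0r ?mulr0.
(* Vectors [x m] nearly norming the [h m] are put together in one sequence [v] with [p v] at most 1,
   so the sum of the norms is at most [H v + eps], and [H v] is at most the norm of [g]. The error
   is divided by [size G] plus 1, positive even for an empty [G]. *)
- apply/ler_addgt0Pr => eps eps0.
  pose n := size G; have n0 : 0 < n.+1%:R :> K by [].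
  have en : 0 < eps / n.+1%:R by rewrite divr_gt0.
  have /choice[x xP] m := dual_norm_approx frm (h m) en.
  apply: (@le_trans _ _ (\sum_(m <- G) (h m (iota (x m)) + eps / n.+1%:R))).
    by apply: ler_sum => m _; have [] := xP m.
  rewrite big_split lerD//=.
    pose v := \sum_(m <- G) dg m (iota (r m (x m))).
    have -> : \sum_(m <- G) h m (iota (x m)) = H v.
      by rewrite Hsum; apply: eq_bigr => m _; rewrite hE.
    have Hv0 : 0 <= H v.
      rewrite Hsum sumr_ge0// => m _; rewrite -hE.
      by have [] := xP m.
    rewrite -(ger0_norm Hv0); apply: le_trans (HC _) _.
    rewrite -[leRHS]mulr1 ler_wpM2l//; apply: ple => // m mG.
    rewrite /v (sumE (fun m => iota (r m (x m)))) mG; apply: le_trans (r_le _ _) _.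
    by have [] := xP m.
  rewrite big_const_seq count_predT iter_addr_0 -/n.
  rewrite -[leLHS]mulr_natr -mulrA ler_piMr ?(ltW eps0)//.
  by rewrite mulrC ler_pdivrMr// mul1r ler_nat.
Qed.

End Decomposition.

Lemma fset_lt_bound (D : {fset nat}) : exists n, forall i, (n <= i)%N -> i \notin D.
Proof.
exists (\max_(i <- D) i.+1)%N => i; apply: contraTN => iD.
by rewrite -ltnNge; apply: (leq_bigmax_seq (F := fun i => i.+1)).
Qed.

(** * Rigid vectors and the supports of rigid functionals *)

Section Rigid.
Variables (K : numFieldType) (V : normedModType K).

(* For a vector of norm 1 this says that it is an extreme point of the unit
   ball. *)
Definition rigid (f : V) : Prop :=
  forall h, `|h| + `|f - h| <= `|f| -> exists c, h = c *: f.

(** If the directions [u] and [v] of [h] and [f - h] differ, strict convexity makes the triangle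
    inequality strict, against the hypothesis; if they agree, [h] and [f] are proportional. *)
Lemma strictly_convex_rigid (W : set V) (f h : V) :
  (forall u v, W u -> W v -> `|u| = 1 -> `|v| = 1 -> u <> v -> `|u + v| < 2) ->
  (forall (a : K) u, W u -> W (a *: u)) ->
  W h -> W (f - h) -> `|h| + `|f - h| <= `|f| -> exists c, h = c *: f.
Proof.
move=> scW WZ Wh Wk; set k := f - h.
have fE : f = h + k by rewrite addrC subrK.
have [->|h0] := eqVneq h 0; first by exists 0; rewrite scale0r.
have [k0|k0] := eqVneq k 0; first by exists 1; rewrite scale1r fE k0 addr0.
have nh : 0 < `|h| by rewrite normr_gt0.
have nk : 0 < `|k| by rewrite normr_gt0.
pose u := `|h|^-1 *: h; pose v := `|k|^-1 *: k.
have hE : h = `|h| *: u by rewrite scalerA mulfV ?gt_eqF// scale1r.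
have kE : k = `|k| *: v by rewrite scalerA mulfV ?gt_eqF// scale1r.
have u1 : `|u| = 1 by rewrite normrZ normfV normr_id mulVf ?gt_eqF.
have v1 : `|v| = 1 by rewrite normrZ normfV normr_id mulVf ?gt_eqF.
have [uv|uv] := pselect (u = v).
  have nhk : `|h| + `|k| != 0 by rewrite gt_eqF ?addr_gt0.
  move=> _; exists (`|h| / (`|h| + `|k|)).
  have -> : f = (`|h| + `|k|) *: u.
    by rewrite fE [X in X + _]hE [X in _ + X]kE -uv scalerDl.
  by rewrite scalerA divfK.
have uv2 : `|u + v| < 2 by apply: scW => //; exact: WZ.
suff lt : `|f| < `|h| + `|k| by move=> /le_lt_trans/(_ lt); rewrite ltxx.
(* The identity a x + b y = a (x + y) + (b - a) y passes from a sum of unit vectors to unequal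
   coefficients, the smaller one first. *)
have half (a b : K) (x y : V) : 0 < a -> a <= b -> `|y| = 1 -> `|x + y| < 2 ->
    `|a *: x + b *: y| < a + b.
  move=> a0 ab y1 xy.
  have -> : a *: x + b *: y = a *: (x + y) + (b - a) *: y.
    by rewrite scalerDr scalerBl -addrA [X in _ = _ + X]addrCA subrr addr0.
  apply: le_lt_trans (ler_normD _ _) _; rewrite !normrZ y1 mulr1.
  rewrite (gtr0_norm a0) ger0_norm ?subr_ge0//.
  have -> : a + b = a * 2 + (b - a) by ring.
  by rewrite ltrD2r ltr_pM2l.
rewrite fE [X in `|X + _|]hE [X in `|_ + X|]kE.
have [hk|kh] := real_leP (gtr0_real nh) (gtr0_real nk); first exact: half.
by rewrite addrC [ltRHS]addrC; apply: half => //; [exact: ltW|rewrite addrC].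
Qed.

(** By the triangle inequality, splitting a piece [g] of [f] further without loss of norm gives
    pieces of [f]. The case [g = f] covers a splitting of [f] itself. *)
Lemma rigid_pieces (I : eqType) (r : seq I) (h : I -> V) (f g : V) :
  g = \sum_(m <- r) h m -> \sum_(m <- r) `|h m| <= `|g| -> uniq r ->
  `|g| + `|f - g| <= `|f| ->
  forall m, m \in r -> `|h m| + `|f - h m| <= `|f|.
Proof.
move=> gE hg ur gf m mr; apply: le_trans gf.
have -> : f - h m = (f - g) + \sum_(i <- r | i != m) h i.
  by rewrite gE (bigD1_seq m)//= opprD addrA subrK.
apply: le_trans (_ : `|h m| + (`|f - g| + \sum_(i <- r | i != m) `|h i|) <= _).
  rewrite lerD2l (le_trans (ler_normD _ _))// lerD2l; exact: ler_norm_sum.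
rewrite addrCA addrC lerD2r; apply: le_trans hg.
by rewrite [leRHS](bigD1_seq m).
Qed.

End Rigid.

Section CombRigid.
Variables (R : realType) (s : scalar_kind).
Notation K := (scalars R s).
Variables (E : normedModType K) (iotaE : {linear c00 K -> E}).
Variables (F : set {fset nat}) (combF : combinatorial_family F).
Variables (X : normedModType K) (iota : {linear c00 K -> X}).
Hypothesis frmE : unconditional_frame iotaE.
Hypothesis cfX : comb_frame iotaE F iota.
Local Notation e i := (iota (c00_delta K i)).
Local Notation eE i := (iotaE (c00_delta K i)).
Let frm : unconditional_frame iota. Proof. by have [] := cfX. Qed.

(* The support of g lies in the pointwise closure of F. *)
Definition admissible (g : dual X) : Prop :=
  forall A : {fset nat}, (forall i, i \in A -> g (e i) != 0) -> F A.

Lemma functional_restr (W : normedModType K) (j : {linear c00 K -> W}) (g : dual W)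
    (A : {fset nat}) (x : c00 K) :
  (forall i, x i != 0 -> g (j (c00_delta K i)) != 0 -> i \in A) ->
  g (j x) = g (j (c00_restr (mem A) x)).
Proof.
move=> Ax; have [n xn] := c00_bound x.
have rn i : (n <= i)%N -> c00_restr (mem A) x i = 0.
  by move=> /xn xi; change ((i \in A)%:R * x i = 0); rewrite xi mulr0.
rewrite (functional_c00 j xn) (functional_c00 j rn) !linear_sum.
apply: eq_bigr => i _; rewrite !linearZ /=.
change (x i * g (j (c00_delta K i)) =
  ((i : nat) \in A)%:R * x i * g (j (c00_delta K i))).
case: (boolP ((i : nat) \in A)) => [|iA]; first by rewrite mul1r.
have [->|xi] := eqVneq (x i) 0; first by rewrite mulr0.
have [->|gi] := eqVneq (g (j (c00_delta K i))) 0; first by rewrite !mulr0.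
by rewrite (Ax _ xi gi) in iA.
Qed.

(** On a vector [x], [g] sees only the common support of [x] and [g], which is in [F]; on vectors
    supported by a member of [F] the norms of [X] and [E] coincide. *)
Lemma admissible_lift (g : dual X) : admissible g ->
  exists h : dual E, (forall i, h (eE i) = g (e i)) /\ `|h| = `|g|.
Proof.
move=> adm; have [_ ub le] := cfX.
have suppP (x : c00 K) : exists2 A : {fset nat}, F A &
    forall i, x i != 0 -> g (e i) != 0 -> i \in A.
  have [B BE] := c00_support x.
  exists [fset i in B | g (e i) != 0]%fset.
    by apply: adm => i; rewrite !inE/= => /andP[].
  by move=> i xi gi; rewrite !inE/= BE xi.
have XE A x : F A -> `|iota (c00_restr (mem A) x)| <= `|iotaE (c00_restr (mem A) x)|.
  move=> FA; apply: le => B FB; apply: (frame_unc frmE) => i; exact: c00_restr_le.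
have gl : scalar (fun x : c00 K => g (iota x) : K).
  by move=> a x y; rewrite !linearP.
have [f fE] : exists f : {scalar c00 K}, forall x, f x = g (iota x).
  pose fm := GRing.isLinear.Build K (c00 K) K *%R
    (fun x : c00 K => g (iota x) : K) gl.
  by exists (HB.pack (fun x : c00 K => g (iota x) : K) fm : {scalar c00 K}).
have [//||h [hE hg]] := dual_c00_extension (iota := iotaE) (phi := f) (C := `|g|).
  move=> x; rewrite fE; have [A FA Ax] := suppP x.
  rewrite (functional_restr Ax); apply: le_trans (dual_bound _ _) _.
  rewrite ler_wpM2l// (le_trans (XE _ _ FA))//.
  by apply: (frame_unc frmE) => i; exact: c00_restr_le.
exists h; split=> [i|]; first by rewrite hE fE.
apply/eqP; rewrite eq_le hg/=.
apply: (dual_c00_norm_le frm) => // x; have [A FA Ax] := suppP x.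
rewrite (functional_restr Ax) -fE -hE; apply: le_trans (dual_bound _ _) _.
by rewrite ler_wpM2l// ub.
Qed.

Lemma admissible_lift_norm (g : dual X) (h : dual E) : admissible g ->
  (forall i, h (eE i) = g (e i)) -> `|h| = `|g|.
Proof.
move=> /admissible_lift[k [kE <-]] hE; congr `|_|.
by apply: (dual_c00_ext frmE) => i; rewrite hE kE.
Qed.

(** Along a set [A] outside [F] where [g] does not vanish, the pieces would be multiples of [g]
    vanishing at points of [A], hence 0, and [g] with them. *)
Lemma rigid_admissible (g : dual X) : rigid g -> g != 0 -> admissible g.
Proof.
move=> rg g0 A gA; apply: contrapT => nFA.
have [h [gE h0 hg]] := dual_decomposition combF frmE cfX g nFA.
move/eqP: g0; apply; rewrite gE big_seq big1// => m mA.
have gg : `|g| + `|g - g| <= `|g| by rewrite subrr normr0 addr0.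
have [c hc] := rg _ (rigid_pieces gE hg (fset_uniq A) gg mA).
have := h0 m mA; rewrite hc dual_scaleE => /eqP.
by rewrite mulf_eq0 (negbTE (gA _ mA)) orbF => /eqP ->; rewrite scale0r.
Qed.

(* W is the part of the dual of E where strict convexity is available: the whole
   dual, or the finitely supported functionals when the families are compact. *)
Variable W : set (dual E).
Hypothesis WZ : forall (a : K) u, W u -> W (a *: u).
Hypothesis Wfin : forall (u : dual E) n, (forall i, (n <= i)%N -> u (eE i) = 0) -> W u.
Hypothesis Wsc : forall u v, W u -> W v -> `|u| = 1 -> `|v| = 1 -> u <> v ->
  `|u + v| < 2.

Lemma supported_admissible (D : {fset nat}) (f : dual X) : F D ->
  (forall i, i \notin D -> f (e i) = 0) -> admissible f.
Proof.
move=> FD fD A fA; apply: combF.2 FD; apply/fsubsetP => i /fA.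
by apply: contraNT => /fD ->.
Qed.

(** Cutting [h] down to [D] keeps the splitting norm-additive and brings it into the dual of [E],
    where strict convexity applies. Outside [D] nothing is learnt about [h] unless [c = 0]. *)
Lemma rigid_on_support (D : {fset nat}) (f h : dual X) : F D ->
  (forall i, i \notin D -> f (e i) = 0) -> `|h| + `|f - h| <= `|f| ->
  exists c, (forall i, i \in D -> h (e i) = c * f (e i)) /\ (c = 0 -> h = 0).
Proof.
move=> FD fD hf; pose a i : K := (i \in D)%:R.
have a1 i : `|a i| <= 1 by rewrite /a; case: (i \in D); rewrite ?normr1 ?normr0.
have [hD [hDE hDn]] := dual_multiplier frm h a1.
have kDn : `|f - hD| <= `|f - h|.
  apply: (dual_unc frm) => i; rewrite !dual_subE hDE /a.
  by case: (boolP (i \in D)) => [|/fD ->]; rewrite ?mul1r// mul0r subr0 normr0.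
have hD0 i : i \notin D -> hD (e i) = 0 by move=> iD; rewrite hDE /a (negbTE iD) mul0r.
have kD0 i : i \notin D -> (f - hD) (e i) = 0.
  by move=> iD; rewrite dual_subE fD// hD0// subrr.
have [n nD] := fset_lt_bound D.
have [f' [f'E f'n]] := admissible_lift (supported_admissible FD fD).
have [h' [h'E h'n]] := admissible_lift (supported_admissible FD hD0).
have k'n : `|f' - h'| = `|f - hD|.
  apply: admissible_lift_norm (supported_admissible FD kD0) _ => i.
  by rewrite !dual_subE f'E h'E.
have [|||c cE] := strictly_convex_rigid (f := f') (h := h') Wsc WZ.
- by apply: (Wfin (n := n)) => i /nD iD; rewrite h'E hD0.
- by apply: (Wfin (n := n)) => i /nD iD; rewrite dual_subE f'E h'E -dual_subE kD0.
- by rewrite h'n k'n f'n; apply: le_trans hf; rewrite lerD.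
exists c; split=> [i iD|c0].
  have := hDE i; rewrite /a iD mul1r => <-.
  by rewrite -h'E cE dual_scaleE f'E.
(* If [c = 0] then [hD = 0], so [f - h] has at least the norm of [f] and nothing is left for [h]. *)
apply/eqP; rewrite -normr_le0.
have hD00 : `|hD| = 0 by rewrite -h'n cE c0 scale0r normr0.
have fk : `|f| <= `|f - hD|.
  by rewrite -{1}(subrK hD f) (le_trans (ler_normD _ _))// hD00 addr0.
by have := le_trans hf (le_trans fk kDn); rewrite gerDr.
Qed.

(* At a point k with D + k outside F, the piece h is split again along D + k; the
   new pieces vanishing at a point of D are zero, which leaves only the one
   vanishing at k. *)
Lemma full_support_rigid (D : {fset nat}) (f : dual X) : F D ->
  (forall i, (f (e i) != 0) = (i \in D)) -> rigid f.
Proof.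
move=> FD fD h hf.
have f0 i : i \notin D -> f (e i) = 0 by rewrite -fD negbK => /eqP.
have [c [hc _]] := rigid_on_support FD f0 hf.
exists c; apply: (dual_c00_ext frm) => k; rewrite dual_scaleE.
have [/hc//|kD] := boolP (k \in D); rewrite (f0 k kD) mulr0.
have [FDk|nFDk] := pselect (F (k |` D)%fset).
  have [|c' [hc' _]] := rigid_on_support FDk _ hf.
    by move=> i; rewrite !inE negb_or => /andP[_ /f0].
  by rewrite hc' ?(f0 k)// ?mulr0// !inE eqxx.
have [u [hE u0 un]] := dual_decomposition combF frmE cfX h nFDk.
rewrite hE dual_sumE big_seq big1// => m; have [->|mk mD] := eqVneq m k.
  exact: u0.
have [c' [uc' c'0]] := rigid_on_support FD f0 (rigid_pieces hE un (fset_uniq _) hf mD).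
move: (mD); rewrite !inE (negbTE mk)/= => mD'.
have := u0 m mD; rewrite uc'// => /eqP.
by rewrite mulf_eq0 -[_ == 0 in X in _ || X]negbK fD mD' orbF => /eqP/c'0 ->.
Qed.

End CombRigid.

(** * Isometries of the duals *)

Section WeakStarLimits.
Variables (R : realType) (s : scalar_kind).
Notation K := (scalars R s).

Lemma weak_star_continuous_cvg (X1 X2 : normedModType K) (J : dual X1 -> dual X2)
    (f_ : nat -> dual X1) (f : dual X1) (x : X2) :
  weak_star_continuous J ->
  (forall v, (fun n => f_ n v) @ \oo --> f v) ->
  (fun n => J (f_ n) x) @ \oo --> J f x.
Proof.
move=> Jc ff.
have fw : (f_ : nat -> weak_star X1) @ \oo --> (f : weak_star X1).
  move=> U [_ /= [[B oB <-] Bf]] /filterS; apply.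
  have : {ptws, (fun n => dual_fun (f_ n)) @ \oo --> (dual_fun f : X1 -> K^o)}.
    by apply/pointwise_cvgP.
  by apply; exact: open_nbhs_nbhs.
have Jw : (fun n => J (f_ n) : weak_star X2) @ \oo --> (J f : weak_star X2).
  exact: cvg_comp fw (Jc _).
have dc : continuous (@dual_fun R s X2 : weak_star X2 -> {ptws X2 -> K^o}).
  exact: initial_continuous.
have := cvg_comp _ _ Jw (dc (J f)).
by move=> /pointwise_cvgP /(_ x).
Qed.
End WeakStarLimits.

(** [S] is the limit of its initial segments, which are in [F]; closedness makes it the
    characteristic function of a finite set. *)
Lemma compact_family_bounded (F : set {fset nat}) (S : pred nat) :
  compact_family F -> (forall A : {fset nat}, (forall i, i \in A -> S i) -> F A) ->
  exists n, forall i, (n <= i)%N -> ~~ S i.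
Proof.
move=> cF FS.
pose A n : {fset nat} := [fset i in seq.iota 0 n | S i]%fset.
have FA n : F (A n) by apply: FS => i; rewrite !inE/= => /andP[].
have AS : (fun n => (fun i => i \in A n) : cantor_space) @ \oo --> (S : cantor_space).
  have : {ptws, (fun n => (fun i => i \in A n)) @ \oo --> (S : nat -> bool)}.
    apply/pointwise_cvgP => i; apply: cvg_near_cst; exists i.+1 => // n /= ni.
    by rewrite !inE/= mem_iota add0n ni.
  by [].
have [|B FB BS] := closed_cvg _ cF _ _ AS.
  by apply: nearW => n; exists (A n).
have [n nB] := fset_lt_bound B.
by exists n => i /nB; rewrite -(congr1 (fun f => f i) BS).
Qed.

Lemma fresh_scalar (K : numFieldType) (l : seq K) : exists t, t \notin l.
Proof.
pose m := [seq n%:R : K | n <- seq.iota 0 (size l).+1].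
have um : uniq m.
  by rewrite map_inj_uniq ?iota_uniq// => i j /eqP; rewrite eqr_nat => /eqP.
apply: contrapT => nl.
have : {subset m <= l}.
  by move=> t _; apply: contrapT => /negP tl; apply: nl; exists t.
by move=> /(uniq_leq_size um); rewrite size_map size_iota ltnn.
Qed.

Lemma isometry_inverse (K : numFieldType) (V1 V2 : normedModType K)
    (J : {linear V1 -> V2}) : surjective_isometry J ->
  exists Ji : {linear V2 -> V1},
    [/\ cancel J Ji, cancel Ji J & forall v, `|Ji v| = `|v|].
Proof.
move=> [Jn Js].
have Jinj : injective J.
  move=> u v Juv; apply/eqP; rewrite -subr_eq0 -normr_eq0 -Jn linearB Juv.
  by rewrite subrr normr0.
have /choice[g gJ] w : exists v, J v = w.
  by have [v _ <-] : range J w; [rewrite Js | exists v].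
have gl : linear g by move=> a u v; apply: Jinj; rewrite linearP !gJ.
pose gL := GRing.isLinear.Build K V2 V1 *:%R g gl.
exists (HB.pack g gL : {linear V2 -> V1}); split=> [v|v|v] /=.
- by apply: Jinj; rewrite gJ.
- exact: gJ.
- by rewrite -Jn gJ.
Qed.

Section Isometry.
Variables (R : realType) (s : scalar_kind).
Notation K := (scalars R s).
Variables (E : normedModType K) (iotaE : {linear c00 K -> E}).
Hypothesis frmE : unconditional_frame iotaE.
Variables (F1 F2 : set {fset nat}).
Hypotheses (combF1 : combinatorial_family F1) (combF2 : combinatorial_family F2).
Variables (X1 X2 : normedModType K).
Variables (iota1 : {linear c00 K -> X1}) (iota2 : {linear c00 K -> X2}).
Hypothesis cf1 : comb_frame iotaE F1 iota1.
Hypothesis cf2 : comb_frame iotaE F2 iota2.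
Variables (J : {linear dual X1 -> dual X2}) (Ji : {linear dual X2 -> dual X1}).
Hypotheses (JK : cancel J Ji) (JiK : cancel Ji J).
Hypotheses (Jn : forall f, `|J f| = `|f|) (Jin : forall f, `|Ji f| = `|f|).
Local Notation eE i := (iotaE (c00_delta K i)).
Local Notation e1 i := (iota1 (c00_delta K i)).
Local Notation e2 i := (iota2 (c00_delta K i)).
Local Notation ecE := (coordf (fun j => iotaE (c00_delta K j))).
Local Notation ec1 := (coordf (fun j => iota1 (c00_delta K j))).
Local Notation ec2 := (coordf (fun j => iota2 (c00_delta K j))).
Let frm1 : unconditional_frame iota1. Proof. by have [] := cf1. Qed.
Let frm2 : unconditional_frame iota2. Proof. by have [] := cf2. Qed.

Definition disjoint_images : Prop := forall j k m, j <> k ->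
  J (ec1 j) (e2 m) = 0 \/ J (ec1 k) (e2 m) = 0.

(* What is used of the w*-continuity of J, or of J Z1 = Z2. *)
Definition coordinatewise_limits : Prop := forall f m,
  (exists k, f = Ji (ec2 k)) ->
  (fun n => J (dual_trunc iota1 n f) (e2 m)) @ \oo --> J f (e2 m).

Lemma J_trunc n f m : J (dual_trunc iota1 n f) (e2 m) =
  \sum_(j < n) f (e1 j) * J (ec1 j) (e2 m).
Proof.
have -> : dual_trunc iota1 n f = \sum_(j < n) f (e1 j) *: ec1 j.
  apply: (dual_c00_ext frm1) => i; rewrite (dual_truncE frm1) dual_sumE.
  rewrite (eq_bigr (fun j : 'I_n => f (e1 j) * (i == j)%:R)); last first.
    by move=> j _; rewrite dual_scaleE (coordfE frm1).
  case: ltnP => [iN|ni].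
    rewrite (bigD1 (Ordinal iN))//= eqxx mulr1 big1 ?addr0// => j ji.
    rewrite (_ : (i == j) = false) ?mulr0//.
    by apply/negbTE; apply: contraNneq ji => ij; apply/eqP/val_inj.
  by rewrite big1// => j _; rewrite gtn_eqF ?mulr0// (leq_trans (ltn_ord j)).
by rewrite linear_sum dual_sumE; apply: eq_bigr => j _; rewrite linearZ.
Qed.

Lemma dual_coord_neq0 (X : normedModType K) (iota : {linear c00 K -> X}) (f : dual X) :
  unconditional_frame iota -> f != 0 ->
  exists k, f (iota (c00_delta K k)) != 0.
Proof.
move=> frm f0; apply: contrapT => nk; move/eqP: f0; apply.
apply: (dual_c00_ext frm) => i; apply/eqP; apply: contrapT => fi.
by apply: nk; exists i; apply/negP.
Qed.

Lemma Jcoord_neq0 j : J (ec1 j) != 0.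
Proof. by rewrite -normr_eq0 Jn (coordf_norm frm1) oner_neq0. Qed.

Lemma preimage_coord (k : nat) : disjoint_images -> coordinatewise_limits ->
  exists j, J (ec1 j) = J (ec1 j) (e2 k) *: ec2 k.
Proof.
move=> dJ cl; pose f := Ji (ec2 k).
have lim m : (fun n => \sum_(j < n) f (e1 j) * J (ec1 j) (e2 m)) @ \oo -->
    ((m == k)%:R : K^o).
  have := cl f m (ex_intro _ k erefl); rewrite JiK (coordfE frm2).
  by under eq_fun do rewrite J_trunc.
(* Some term of the expansion is nonzero at [k], where the limit is 1; its index is the required
   [j]. *)
have [j fj] : exists j, f (e1 j) * J (ec1 j) (e2 k) != 0.
  apply: contrapT => nj.
  have h : (fun n => \sum_(j < n) f (e1 j) * J (ec1 j) (e2 k)) @ \oo --> (0 : K^o).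
    apply: cvg_near_cst; apply: nearW => n; apply: big1 => i _.
    by apply/eqP; apply: contrapT => fi; apply: nj; exists (i : nat); apply/negP.
  have /eqP : (k == k)%:R = 0 :> K^o.
    exact: (cvg_unique (@norm_hausdorff _ _) (lim k) h).
  by rewrite eqxx oner_eq0.
exists j; apply: (dual_c00_ext frm2) => m; rewrite dual_scaleE (coordfE frm2).
have [->|mk] := eqVneq m k; first by rewrite mulr1.
rewrite mulr0; apply/eqP; apply: contrapT => /negP Jm.
have f0 : f (e1 j) != 0 by apply: contraNneq fj => ->; rewrite mul0r.
(* If [J (ec1 j)] did not vanish at [m], disjointness would leave only the [j]-th term there, and
   the limit, which is 0, would be nonzero. *)
have h : (fun n => \sum_(i < n) f (e1 i) * J (ec1 i) (e2 m)) @ \oo -->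
    (f (e1 j) * J (ec1 j) (e2 m) : K^o).
  apply: cvg_near_cst; exists j.+1 => // n /= jn.
  rewrite (bigD1 (Ordinal jn))//= big1 ?addr0// => i ij.
  have ij' : (i : nat) <> j by move=> ij'; move/eqP: ij; apply; exact: val_inj.
  case: (dJ _ _ m ij') => [->|J0]; first by rewrite mulr0.
  by rewrite J0 eqxx in Jm.
have : (m == k)%:R = f (e1 j) * J (ec1 j) (e2 m) :> K^o.
  exact: (cvg_unique (@norm_hausdorff _ _) (lim m) h).
rewrite (negbTE mk) => /esym/eqP.
by rewrite mulf_eq0 (negbTE f0) (negbTE Jm).
Qed.

(** [tau] sends [k] to an index whose image is a multiple of [ec2 k]. It is onto: at a coordinate
    [k] where [J (ec1 j)] is nonzero, so is [J (ec1 (tau k))], and disjointness gives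
    [tau k = j]. *)
Lemma coordinate_permutation : disjoint_images -> coordinatewise_limits ->
  exists (pi tau : nat -> nat) (omega : nat -> K),
    [/\ cancel pi tau, cancel tau pi, forall i, `|omega i| = 1 &
        forall i, J (ec1 i) = omega i *: ec2 (pi i)].
Proof.
move=> dJ cl.
have /choice[tau tauE] k := preimage_coord k dJ cl.
have tau0 k : J (ec1 (tau k)) (e2 k) != 0.
  apply: contraNneq (Jcoord_neq0 (tau k)) => J0.
  by rewrite tauE J0 scale0r.
have /choice[pi piE] j : exists k, tau k = j.
  have [k Jk] := dual_coord_neq0 frm2 (Jcoord_neq0 j).
  exists k; apply: contrapT => tj.
  case: (dJ _ _ k tj) => J0; first by have := tau0 k; rewrite J0 eqxx.
  by rewrite J0 eqxx in Jk.
have Jpi i : J (ec1 i) = J (ec1 i) (e2 (pi i)) *: ec2 (pi i).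
  by have := tauE (pi i); rewrite piE.
exists pi, tau, (fun i => J (ec1 i) (e2 (pi i))); split=> //.
- move=> k; have := tauE (pi (tau k)); rewrite piE => h.
  apply/eqP; apply: contrapT => /negP nk.
  have := tau0 k; rewrite h dual_scaleE (coordfE frm2) (eq_sym k).
  by rewrite (negbTE nk) mulr0 eqxx.
- move=> i; rewrite -[LHS]mulr1 -(coordf_norm frm2 (pi i)) -normrZ.
  by rewrite -Jpi Jn (coordf_norm frm1) (coordf_norm frm2).
Qed.

(** * Supports of the images of functionals *)

Lemma rigid_image f : rigid f -> rigid (J f).
Proof.
move=> rf h; rewrite -(JiK h) -linearB !Jn => /rf[c ->].
by exists c; rewrite linearZ.
Qed.

Variable W : set (dual E).
Hypothesis WZ : forall (a : K) u, W u -> W (a *: u).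
Hypothesis Wfin : forall (u : dual E) n, (forall i, (n <= i)%N -> u (eE i) = 0) -> W u.
Hypothesis Wsc : forall u v, W u -> W v -> `|u| = 1 -> `|v| = 1 -> u <> v ->
  `|u + v| < 2.

(** [f] is rigid by strict convexity, [J] preserves rigidity, and nonzero rigid functionals are
    admissible; an empty [D] is treated apart because then [f = 0]. *)
Lemma full_support_image (D : {fset nat}) (f : dual X1) : F1 D ->
  (forall i, (f (e1 i) != 0) = (i \in D)) -> admissible F2 iota2 (J f).
Proof.
move=> FD fD; have [D0|[i iD]] := fset_0Vmem D.
  have -> : f = 0.
    apply: (dual_c00_ext frm1) => i; apply/eqP; apply: contraTT isT.
    by rewrite fD D0 inE.
  move=> A fA; apply: combF2.2 (combF2.1 0%N).
  by apply/fsubsetP => i /fA; rewrite linear0 eqxx.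
apply: (rigid_admissible combF2 frmE cf2).
  apply: rigid_image; exact: (full_support_rigid combF1 frmE cf1 WZ Wfin Wsc FD fD).
by rewrite -normr_eq0 Jn normr_eq0; apply: contraTneq iD => f0; rewrite -fD f0 eqxx.
Qed.

Lemma coord_image_admissible j : admissible F2 iota2 (J (ec1 j)).
Proof.
apply: (full_support_image (combF1.1 j)) => i.
by rewrite (coordfE frm1) inE; case: (i == j); rewrite ?oner_eq0 ?eqxx.
Qed.

(** The sum of the [ec1 i] over [A] has support [A], and its image does not vanish on the image of
    [A]. *)
Lemma permuted_family (pi : nat -> nat) (omega : nat -> K) :
  injective pi -> (forall i, `|omega i| = 1) ->
  (forall i, J (ec1 i) = omega i *: ec2 (pi i)) ->
  forall A, F1 A -> F2 [fset pi i | i in A]%fset.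
Proof.
move=> pinj om Jpi A FA; pose f := coord_sum iota1 A (fun=> 1).
have fE i : f (e1 i) = (i \in A)%:R.
  by rewrite (coord_sumE frm1); case: (i \in A).
apply: (full_support_image FA (f := f)) => [i|k].
  by rewrite fE; case: (i \in A); rewrite ?oner_eq0 ?eqxx.
move=> /imfsetP[i /= iA ->].
rewrite /f /coord_sum linear_sum dual_sumE.
rewrite (eq_bigr (fun j => omega j * (pi i == pi j)%:R)); last first.
  by move=> j _; rewrite scale1r Jpi dual_scaleE (coordfE frm2).
rewrite (bigD1_seq i) ?fset_uniq//= eqxx mulr1 big1 ?addr0.
  by rewrite -normr_eq0 om oner_eq0.
by move=> j ji; rewrite (inj_eq pinj) eq_sym (negbTE ji) mulr0.
Qed.

(** A generic combination of [ec1 j] and [ec1 k] has the pair as its support, while its image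
    vanishes at no point of [A]. *)
Lemma union_admissible j k : j <> k -> F1 [fset j; k]%fset ->
  forall A : {fset nat},
    (forall i, i \in A -> (J (ec1 j) (e2 i) != 0) || (J (ec1 k) (e2 i) != 0)) ->
    F2 A.
Proof.
move=> jk Fjk A uA; set u := J (ec1 j); set v := J (ec1 k).
(* [t] avoids 0, to keep [k] in the support of [f], and the finitely many roots of u + t v at points
   of [A]. *)
have [t tl] := fresh_scalar (0 :: [seq - u (e2 i) / v (e2 i) | i <- A]).
move: tl; rewrite inE negb_or => /andP[t0 tl].
pose f := ec1 j + t *: ec1 k.
have kj : (k == j) = false by apply/eqP => /esym.
have fE i : f (e1 i) = (i == j)%:R + t * (i == k)%:R.
  by rewrite dual_addE dual_scaleE !(coordfE frm1).
apply: (full_support_image Fjk (f := f)) => i.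
  rewrite fE !inE; case: (eqVneq i j) => [->|ij]; last first.
    by case: (i == k); rewrite ?mulr1 ?mulr0 add0r ?eqxx.
  by rewrite (eq_sym j) kj mulr0 addr0 oner_eq0.
have -> : J f = u + t *: v by rewrite /f linearD linearZ.
move=> iA; rewrite dual_addE dual_scaleE.
have [v0|v0] := eqVneq (v (e2 i)) 0.
  by have := uA i iA; rewrite -/u -/v v0 eqxx orbF mulr0 addr0.
apply: contra tl => uv; apply/mapP; exists i => //.
move: uv; rewrite addrC addr_eq0 => /eqP uv.
by rewrite -uv mulfK.
Qed.

(** Automatic when [W] is the whole dual; when [W] is the span of the coordinate functionals it
    comes from compactness of [F2]. *)
Hypothesis Wadm : forall (g : dual X2) (h : dual E), admissible F2 iota2 g ->
  (forall i, h (eE i) = g (e2 i)) -> W h.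

(** Since [F1] contains the pair, the norm of the plane is the same in the duals of [X1] and [E];
    since every combination of the two images is admissible, their span lifts isometrically to the
    dual of [E]. The composite is the embedding to which the assumption applies. *)
Lemma disjoint_embeddings_images j k m :
  disjoint_embeddings (fun i => eE i) W -> j <> k -> F1 [fset j; k]%fset ->
  J (ec1 j) (e2 m) = 0 \/ J (ec1 k) (e2 m) = 0.
Proof.
move=> dE jk Fjk.
have [u [uE un]] := admissible_lift frmE cf2 (@coord_image_admissible j).
have [v [vE vn]] := admissible_lift frmE cf2 (@coord_image_admissible k).
have adm a b : admissible F2 iota2 (a *: J (ec1 j) + b *: J (ec1 k)).
  move=> A abA; apply: (union_admissible jk Fjk) => i /abA.
  rewrite dual_addE !dual_scaleE; apply: contraNT.
  by rewrite negb_or !negbK => /andP[/eqP-> /eqP->]; rewrite !mulr0 addr0.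
have lift a b i : (a *: u + b *: v) (eE i) = (a *: J (ec1 j) + b *: J (ec1 k)) (e2 i).
  by rewrite !dual_addE !dual_scaleE uE vE.
have kj : (k == j) = false by apply/eqP => /esym.
have jk' : (j == k) = false by apply/eqP.
(* [T] is defined on the whole dual by the coordinates [j] and [k]; isometry is claimed only on the
   span [S]. *)
pose T (f : dual E) : dual E := f (eE j) *: u + f (eE k) *: v.
have := dE j k T jk; set S := linear_span _; move=> /(_ _ _)/seteqP.
case=> [||h _].
- split=> [a f g _ _|f Sf].
    by rewrite /T !dual_addE !dual_scaleE !scalerDl -!scalerA scalerDr addrACA.
  rewrite (admissible_lift_norm frmE cf2 (adm (f (eE j)) (f (eE k)))); last first.
    by move=> i; exact: lift.
  rewrite -!linearZ -linearD Jn.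
  apply/esym; apply: (admissible_lift_norm frmE cf1) => [A|i].
    move=> gA; apply: combF1.2 Fjk; apply/fsubsetP => i /gA.
    rewrite dual_addE !dual_scaleE !(coordfE frm1) !inE; apply: contraNT.
    by rewrite negb_or => /andP[/negbTE -> /negbTE ->]; rewrite !mulr0 addr0.
  rewrite dual_addE !dual_scaleE !(coordfE frm1).
  have fi : i != j -> i != k -> f (eE i) = 0.
    move=> ij ik; have [n [a [w [wS ->]]]] := Sf.
    rewrite dual_sumE big1// => l _; rewrite dual_scaleE.
    by case: (wS l) => ->; rewrite (coordfE frmE) ?(negbTE ij) ?(negbTE ik) mulr0.
  case: (eqVneq i j) fi => [-> _|_]; first by rewrite jk' mulr1 mulr0 addr0.
  case: (eqVneq i k) => [->|_ ->//]; first by rewrite mulr1 mulr0 add0r.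
  by rewrite !mulr0 addr0.
- move=> _ [f _ <-]; apply: (Wadm (adm (f (eE j)) (f (eE k)))) => i.
  exact: lift.
have Tj : T (ecE j) = u by rewrite /T !(coordfE frmE) eqxx kj scale1r scale0r addr0.
have Tk : T (ecE k) = v by rewrite /T !(coordfE frmE) eqxx jk' scale1r scale0r add0r.
have [|um] := eqVneq (J (ec1 j) (e2 m)) 0; first by left.
have [|vm] := eqVneq (J (ec1 k) (e2 m)) 0; first by right.
by case: (h m); rewrite /dual_support Tj Tk; split; rewrite /= ?uE ?vE.
Qed.

(** Tested on e_j + l^-1 e_k, whose norm is at most 1 because no member of [F1] contains both [j]
    and [k]. *)
Lemma coord_pair_norm j k (l : K) : j <> k -> ~ F1 [fset j; k]%fset ->
  `|l| = 1 -> 2 <= `|ec1 j + l *: ec1 k|.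
Proof.
move=> jk nF l1; have l0 : l != 0 by rewrite -normr_eq0 l1 oner_neq0.
have kj : (k == j) = false by apply/eqP => /esym.
have jk' : (j == k) = false by apply/eqP.
pose x := c00_delta K j + l^-1 *: c00_delta K k.
have xE i : x i = (i == j)%:R + l^-1 * (i == k)%:R by [].
have x1 : `|iota1 x| <= 1.
  have [_ _ le] := cf1; apply: le => A FA.
  have small n : (forall i, i != n -> c00_restr (mem A) x i = 0) ->
      `|c00_restr (mem A) x n| <= 1 -> `|iotaE (c00_restr (mem A) x)| <= 1.
    move=> xn n1; rewrite -(frame_delta_norm frmE n).
    apply: (frame_unc frmE) => i.
    change (`|c00_restr (mem A) x i| <= `|(i == n)%:R|).
    by case: (eqVneq i n) => [->|/xn ->]; rewrite ?normr1// normr0.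
  have rE i : c00_restr (mem A) x i = (i \in A)%:R * x i by [].
  have [kA|kA] := boolP (k \in A).
    have jA : j \notin A.
      apply/negP => jA; apply: nF; apply: combF1.2 FA.
      by apply/fsubsetP => i; rewrite !inE => /orP[/eqP->|/eqP->].
    apply: (small k) => [i ik|]; rewrite rE xE.
      rewrite (negbTE ik) mulr0 addr0; case: (eqVneq i j) => [->|_].
        by rewrite (negbTE jA) mul0r.
      by rewrite mulr0.
    by rewrite kA mul1r kj add0r eqxx mulr1 normfV l1 invr1.
  apply: (small j) => [i ij|]; rewrite rE xE.
    rewrite (negbTE ij) add0r; case: (eqVneq i k) => [->|_].
      by rewrite (negbTE kA) mul0r.
    by rewrite !mulr0.
  rewrite eqxx jk' mulr0 addr0 mulr1; case: (j \in A); rewrite ?normr1//.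
  by rewrite normr0.
have : `|(ec1 j + l *: ec1 k) (iota1 x)| <= `|ec1 j + l *: ec1 k|.
  by apply: le_trans (dual_bound _ _) _; rewrite ler_piMr.
have -> : iota1 x = e1 j + l^-1 *: e1 k by rewrite linearD linearZ.
rewrite dual_addr dual_scaler !dual_addE !dual_scaleE.
rewrite !(coordfE frm1) !eqxx kj jk' mulr0 addr0 add0r mulr1 mulVf//.
by rewrite ger0_norm.
Qed.

(** Changing the sign of the coordinate [m] gives another vector [us] of norm 1, distinct from [u];
    [u0] is their midpoint, and strict convexity applies to the lifts in [W]. *)
Lemma zero_coordinate_norm (u : dual X2) m :
  admissible F2 iota2 u -> `|u| = 1 -> u (e2 m) != 0 ->
  exists2 u0 : dual X2, `|u0| < 1 & u = u0 + u (e2 m) *: ec2 m.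
Proof.
move=> adm u1 um.
have [|u0 [u0E _]] := dual_multiplier frm2 u (a := fun i => (i != m)%:R).
  by move=> i; case: (i != m); rewrite ?normr1 ?normr0.
have [|us [usE usn]] := dual_multiplier frm2 u (a := fun i => if i == m then -1 else 1).
  by move=> i; case: (i == m); rewrite ?normrN ?normr1.
have us1 : `|us| = 1.
  rewrite -u1; apply/eqP; rewrite eq_le usn/=; apply: (dual_unc frm2) => i.
  by rewrite usE; case: (i == m); rewrite ?mulN1r ?normrN ?mul1r.
have sub (g : dual X2) : (forall i, u (e2 i) = 0 -> g (e2 i) = 0) -> admissible F2 iota2 g.
  by move=> ug A gA; apply: adm => i /gA; apply: contraNneq => /ug ->.
have admS : admissible F2 iota2 us by apply: sub => i ui; rewrite usE ui mulr0.
have admD : admissible F2 iota2 (u + us).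
  by apply: sub => i ui; rewrite dual_addE usE ui mulr0 addr0.
have [v [vE vn]] := admissible_lift frmE cf2 adm.
have [vs [vsE vsn]] := admissible_lift frmE cf2 admS.
exists u0.
  have u2 : u + us = 2 *: u0.
    apply: (dual_c00_ext frm2) => i; rewrite dual_addE dual_scaleE usE u0E.
    by case: (i == m); rewrite /=; ring.
  rewrite -(ltr_pM2l (ltr0n K 2)) mulr1.
  have -> : 2 * `|u0| = `|u + us| by rewrite u2 normrZ ger0_norm.
  rewrite -(admissible_lift_norm frmE cf2 admD (h := v + vs)); last first.
    by move=> i; rewrite !dual_addE vE vsE.
  apply: Wsc; [exact: Wadm adm vE|exact: Wadm admS vsE|by rewrite vn|by rewrite vsn|].
  move=> /(congr1 (fun f : dual E => f (eE m))); rewrite vE vsE usE eqxx => /eqP.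
  rewrite mulN1r -addr_eq0 -mulr2n mulrn_eq0/=; exact/negP.
apply: (dual_c00_ext frm2) => i.
rewrite dual_addE dual_scaleE u0E (coordfE frm2).
by case: (eqVneq i m) => [->|_]; rewrite ?mul0r ?add0r ?mulr1 ?mul1r ?mulr0 ?addr0.
Qed.

(** With [l] such that l v is opposite to [u] at [m], the coordinate [u (e2 m)] can be moved from
    [u] to l v without bringing the norm of the latter above 1, and what remains of [u] has norm
    less than 1: the total is less than 2. *)
Lemma sum_norm_disjoint (u v : dual X2) m :
  admissible F2 iota2 u -> `|u| = 1 -> `|v| = 1 ->
  (forall l : K, `|l| = 1 -> 2 <= `|u + l *: v|) ->
  u (e2 m) != 0 -> ~ `|u (e2 m)| <= `|v (e2 m)|.
Proof.
move=> adm u1 v1 uv um uvm.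
have nu : 0 < `|u (e2 m)| by rewrite normr_gt0.
have nv : 0 < `|v (e2 m)| by exact: lt_le_trans uvm.
have vm : v (e2 m) != 0 by rewrite -normr_gt0.
have [u0 u01 uE] := zero_coordinate_norm adm u1 um.
pose t : K := `|v (e2 m)| / `|u (e2 m)|.
have t1 : 1 <= t by rewrite ler_pdivlMr// mul1r.
pose l : K := - (t * u (e2 m) / v (e2 m)).
have lv : l * v (e2 m) = - (t * u (e2 m)) by rewrite mulNr divfK.
have tu : t * `|u (e2 m)| = `|v (e2 m)| by rewrite divfK ?gt_eqF.
have l1 : `|l| = 1.
  rewrite normrN normrM normfV normrM (ger0_norm (le_trans ler01 t1)).
  by rewrite tu divff ?gt_eqF.
pose w := u (e2 m) *: ec2 m + l *: v.
(* At [m] the modulus of [w] is that of [v] minus that of [u]; elsewhere it is that of [v]. *)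
have w1 : `|w| <= 1.
  rewrite -v1; apply: (dual_unc frm2) => i.
  rewrite dual_addE !dual_scaleE (coordfE frm2).
  case: (eqVneq i m) => [->|_]; last by rewrite mulr0 add0r normrM l1 mul1r.
  rewrite mulr1 lv -[X in X - _]mul1r -mulrBl normrM distrC.
  rewrite (@ger0_norm _ (t - 1)) ?subr_ge0//.
  by rewrite mulrBl tu mul1r lerBlDr lerDl.
have := uv l l1; rewrite uE -addrA -/w => h.
have := le_lt_trans h (le_lt_trans (ler_normD _ _) (ltr_leD u01 w1)).
by rewrite ltxx.
Qed.

Lemma disjoint_images_outside j k m : j <> k -> ~ F1 [fset j; k]%fset ->
  J (ec1 j) (e2 m) = 0 \/ J (ec1 k) (e2 m) = 0.
Proof.
move=> jk nF.
have [|jm] := eqVneq (J (ec1 j) (e2 m)) 0; first by left.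
have [|km] := eqVneq (J (ec1 k) (e2 m)) 0; first by right.
exfalso.
have n1 i : `|J (ec1 i)| = 1 by rewrite Jn (coordf_norm frm1).
have jk2 (l : K) : `|l| = 1 -> 2 <= `|J (ec1 j) + l *: J (ec1 k)|.
  by move=> l1; rewrite -linearZ -linearD Jn; exact: coord_pair_norm.
have nF' : ~ F1 [fset k; j]%fset by rewrite fsetUC.
have kj2 (l : K) : `|l| = 1 -> 2 <= `|J (ec1 k) + l *: J (ec1 j)|.
  by move=> l1; rewrite -linearZ -linearD Jn; apply: coord_pair_norm => // /esym.
have [le|/ltW le] := real_leP (normr_real (J (ec1 j) (e2 m)))
    (normr_real (J (ec1 k) (e2 m))).
  exact: (sum_norm_disjoint (@coord_image_admissible j) (n1 j) (n1 k) jk2 jm).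
exact: (sum_norm_disjoint (@coord_image_admissible k) (n1 k) (n1 j) kj2 km).
Qed.

Lemma disjoint_embeddings_disjoint :
  disjoint_embeddings (fun i => eE i) W -> disjoint_images.
Proof.
move=> dE j k m jk.
have [Fjk|nF] := pselect (F1 [fset j; k]%fset).
  exact: disjoint_embeddings_images.
exact: disjoint_images_outside.
Qed.

Lemma weak_star_limits : weak_star_continuous J -> coordinatewise_limits.
Proof.
move=> Jc f m _; apply: weak_star_continuous_cvg Jc _ => v.
exact: dual_trunc_cvg.
Qed.

(** [Ji (ec2 k)] lies in the closed span for [X1], where truncations converge in norm. *)
Lemma closed_span_limits :
  J @` coordf_closed_span (fun i => e1 i) = coordf_closed_span (fun i => e2 i) ->
  coordinatewise_limits.
Proof.
move=> JZ _ m [k ->].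
have Zk : coordf_closed_span (fun i => e2 i) (ec2 k).
  apply: subset_closure; exists 1%N, (fun=> 1), (fun=> ec2 k); split.
    by move=> _; exists k.
  by rewrite big_ord1 scale1r.
have [f Zf fE] : (J @` coordf_closed_span (fun i => e1 i)) (ec2 k) by rewrite JZ.
rewrite -fE JK; apply/cvgrPdist_le => eps eps0.
have /cvgrPdist_le/(_ _ eps0) := dual_trunc_cvg_norm frm1 Zf.
apply: filterS => n fn; rewrite -dual_subE -linearB.
apply: le_trans (dual_bound _ _) _.
by rewrite (frame_delta_norm frm2) mulr1 Jn.
Qed.

(** * The plane spanned by two coordinate functionals *)

Lemma coord_pairE (X : normedModType K) (iota : {linear c00 K -> X}) (a b : K) j k i :
  unconditional_frame iota ->
  (a *: coordf (fun l => iota (c00_delta K l)) j +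
   b *: coordf (fun l => iota (c00_delta K l)) k) (iota (c00_delta K i)) =
  a * (i == j)%:R + b * (i == k)%:R.
Proof. by move=> frm; rewrite dual_addE !dual_scaleE !(coordfE frm). Qed.

Lemma coord_pair_abs j k (a b a' b' : K) : j <> k ->
  `|a| = `|a'| -> `|b| = `|b'| ->
  `|a *: ec1 j + b *: ec1 k| = `|a' *: ec1 j + b' *: ec1 k|.
Proof.
move=> jk aa bb; apply/eqP; rewrite eq_le; apply/andP.
have eqn i : `|(a *: ec1 j + b *: ec1 k) (e1 i)| =
    `|(a' *: ec1 j + b' *: ec1 k) (e1 i)|.
  rewrite !(coord_pairE _ _ _ _ _ frm1).
  case: (eqVneq i j) => [->|_].
    have -> : (j == k) = false by apply/eqP.
    by rewrite !mulr1 !mulr0 !addr0.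
  by case: (i == k); rewrite ?mulr1 ?mulr0 ?add0r.
by split; apply: (dual_unc frm1) => i; rewrite eqn.
Qed.

(* Conjugating the rotation of the m-th coordinate of the dual of X2 by J and
   compressing to the span of two coordinate functionals gives contractions of
   that plane. *)
Lemma compressed_rotation j k m (a b z : K) : j <> k -> `|z| = 1 ->
  `|(a + (z - 1) * (J (ec1 j) (e2 m) * a + J (ec1 k) (e2 m) * b) *
      Ji (ec2 m) (e1 j)) *: ec1 j +
    (b + (z - 1) * (J (ec1 j) (e2 m) * a + J (ec1 k) (e2 m) * b) *
      Ji (ec2 m) (e1 k)) *: ec1 k| <= `|a *: ec1 j + b *: ec1 k|.
Proof.
move=> jk z1; set l := J (ec1 j) (e2 m) * a + _; set y := a *: ec1 j + b *: ec1 k.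
have kj : (k == j) = false by apply/eqP => /esym.
have jk' : (j == k) = false by apply/eqP.
(* [h] is the conjugated rotation applied to [y], [l] being the coordinate of [J y] at [m]; keeping
   only its coordinates [j] and [k] gives the left-hand side. *)
pose h := y + ((z - 1) * l) *: Ji (ec2 m).
have Jy : J y (e2 m) = l.
  have -> : J y = a *: J (ec1 j) + b *: J (ec1 k) by rewrite linearD !linearZ.
  by rewrite dual_addE !dual_scaleE /l [a * _]mulrC [b * _]mulrC.
apply: (@le_trans _ _ `|h|).
  apply: (dual_unc frm1) => i.
  rewrite (coord_pairE _ _ _ _ _ frm1) /h dual_addE dual_scaleE (coord_pairE _ _ _ _ _ frm1).
  case: (eqVneq i j) => [->|ij].
    by rewrite jk' !mulr0 !mulr1 !addr0.
  case: (eqVneq i k) => [->|ik]; first by rewrite !mulr0 !mulr1 !add0r.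
  by rewrite !mulr0 addr0 normr0.
rewrite -[leLHS]Jn -[leRHS]Jn /h linearD linearZ JiK.
apply: (dual_unc frm2) => i; rewrite dual_addE dual_scaleE (coordfE frm2).
case: (eqVneq i m) => [->|_]; last by rewrite mulr0 addr0.
by rewrite Jy mulr1 -{1}[l]mul1r -mulrDl addrC subrK normrM z1 mul1r.
Qed.

(** For a pair in [F1] the two norms agree. A pair outside [F1] cannot be Euclidean: the norm of
    [ec1 j + ec1 k] is at least 2, while its square would be 2. *)
Lemma span_is_l22_coord j k : j <> k ->
  span_is_l22 (ec1 j) (ec1 k) -> span_is_l22 (ecE j) (ecE k).
Proof.
move=> jk l22 a b.
have [Fjk|nF] := pselect (F1 [fset j; k]%fset).
  rewrite -l22; congr (_ ^+ 2); apply: (admissible_lift_norm frmE cf1) => [A gA|i].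
    apply: combF1.2 Fjk; apply/fsubsetP => i /gA.
    rewrite (coord_pairE _ _ _ _ _ frm1) !inE; apply: contraNT.
    by rewrite negb_or => /andP[/negbTE -> /negbTE ->]; rewrite !mulr0 addr0.
  by rewrite (coord_pairE _ _ _ _ _ frm1) (coord_pairE _ _ _ _ _ frmE).
have := coord_pair_norm jk nF (normr1 K).
rewrite -[X in X + _]scale1r => h; have := l22 1 1.
rewrite normr1 expr1n => e; exfalso.
have : 2 ^+ 2 <= `|1 *: ec1 j + 1 *: ec1 k| ^+ 2 by rewrite ler_pXn2r ?nnegrE.
by rewrite e expr2 -[X in _ <= X]mulr1 ler_pM2l// (ler_nat K 2 1).
Qed.

(** Some coordinate [i] of [Ji (ec2 m)] is nonzero, so the products force every [J (ec1 l)] with [l]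
    other than [i] to vanish at [m]. *)
Lemma disjoint_images_of_products :
  (forall j k m, j <> k -> J (ec1 k) (e2 m) * Ji (ec2 m) (e1 j) = 0) ->
  disjoint_images.
Proof.
move=> prod j k m jk.
have [i fi] : exists i, Ji (ec2 m) (e1 i) != 0.
  apply: dual_coord_neq0 frm1 _.
  by rewrite -normr_eq0 Jin (coordf_norm frm2) oner_neq0.
have zero l : i <> l -> J (ec1 l) (e2 m) = 0.
  by move=> /(prod _ _ m)/eqP; rewrite mulf_eq0 (negbTE fi) orbF => /eqP.
have [ij|/eqP ij] := eqVneq i j; last by left; apply: zero.
by right; apply: zero; rewrite ij.
Qed.

(** * Compact families *)

Hypothesis compF2 : compact_family F2.

Lemma compact_admissible_bounded (g : dual X2) : admissible F2 iota2 g ->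
  exists n, forall i, (n <= i)%N -> g (e2 i) = 0.
Proof.
move=> adm.
have [n nP] := compact_family_bounded (S := fun i => g (e2 i) != 0) compF2 adm.
by exists n => i /nP; rewrite negbK => /eqP.
Qed.

(** Compactness makes the images of the coordinate functionals finitely supported, so [J] sends the
    truncations of [f] into the span. *)
Lemma image_closed_span :
  J @` coordf_closed_span (fun i => e1 i) `<=` coordf_closed_span (fun i => e2 i).
Proof.
move=> _ [f Zf <-] B /nbhs_ballP[eps /= eps0 epsB].
have /cvgrPdist_lt/(_ _ eps0)[n _ fn] := dual_trunc_cvg_norm frm1 Zf.
have /choice[N NP] j := compact_admissible_bounded (@coord_image_admissible j).
exists (J (dual_trunc iota1 n f)); split.
  apply: (bounded_coord_span frm2 (n := \max_(j < n) N j)) => i iN.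
  rewrite J_trunc big1// => j _; rewrite NP ?mulr0//.
  by apply: leq_trans iN; exact: (leq_bigmax j).
apply: epsB; rewrite -ball_normE /ball_/= -linearB Jn.
exact: (fn n (leqnn n)).
Qed.

End Isometry.

(** * Contractions of a complex plane with an absolute norm *)

(** Applying the bound on both halves of an interval halves the constant, 2 C (d / 2)^2 = (C / 2)
    d^2, and iteration leaves no positive increment. *)
Lemma quadratic_increments_const (R : realType) (f : R -> R) (C : R) :
  (forall x y : R, 0 < x -> 0 < y -> f x - f y <= C * (x - y) ^+ 2) ->
  forall x y : R, 0 < x -> 0 < y -> f x = f y.
Proof.
move=> fC.
have halve n x y : 0 < x -> 0 < y -> f x - f y <= C / 2 ^+ n * (x - y) ^+ 2.
  elim: n x y => [|n IHn] x y x0 y0; first by rewrite expr0 divr1; exact: fC.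
  have m0 : 0 < (x + y) / 2 by lra.
  have := IHn _ _ x0 m0; have := IHn _ _ m0 y0; set D := C / 2 ^+ n.
  have -> : C / 2 ^+ n.+1 = D / 2 by rewrite exprS invfM mulrA mulrAC.
  have -> : (x + y) / 2 - y = (x - y) / 2 by field.
  have -> : x - (x + y) / 2 = (x - y) / 2 by field.
  rewrite expr_div_n; set w := (x - y) ^+ 2; set z := f ((x + y) / 2).
  have -> : D * (w / 2 ^+ 2) = D * w / 4 by field.
  have -> : D / 2 * w = D * w / 2 by field.
  by move=> h1 h2; lra.
have le x y : 0 < x -> 0 < y -> f x <= f y.
  move=> x0 y0; rewrite leNgt; apply/negP; rewrite -subr_gt0 => fxy.
  pose d := f x - f y; pose q := `|C * (x - y) ^+ 2 / d|.
  have [n nq] : exists n : nat, q < n%:R.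
    by exists (Num.truncn q).+1; exact: truncnS_gt.
  have := halve n _ _ x0 y0; rewrite -/d mulrAC ler_pdivlMr ?exprn_gt0//.
  apply/negP; rewrite -ltNge -ltr_pdivrMl// mulrC.
  apply: le_lt_trans (ler_norm _) _; apply: lt_le_trans nq _.
  by rewrite -natrX ler_nat ltnW// ltn_expl.
by move=> x y x0 y0; apply/eqP; rewrite eq_le !le.
Qed.

(** The real part of [(z - 1) * w] cannot be positive; to first order in the angle s of [z] it is -
    s times the imaginary part of [w], and s takes both signs. *)
Lemma rotations_real (R : realType) (N w : R[i]) : 0 <= N ->
  (forall z : R[i], `|z| = 1 -> `|N + (z - 1) * w| <= N) -> w \is Num.real.
Proof.
move=> N0; have NE : N = (complex.Re N)%:C%C by rewrite RRe_real// ger0_real.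
move: N0; rewrite NE ler0c; move: (complex.Re N) => n n0.
case: w => x y h; rewrite complex_real; apply/eqP.
have key t : - (t ^+ 2 * x) <= t * y.
  have D0 : 0 < 1 + t ^+ 2 by rewrite ltr_pwDl// sqr_ge0.
  (* 1 + p + i q = (1 + i t)^2 / (1 + t^2) *)
  pose p := - (2 * t ^+ 2) / (1 + t ^+ 2); pose q := 2 * t / (1 + t ^+ 2).
  have pq : (1 + p) ^+ 2 + q ^+ 2 = 1.
    by rewrite /p /q; field; rewrite gt_eqF.
  have := h (Complex (1 + p) q); rewrite normc_def/= pq sqrtr1 => /(_ erefl).
  rewrite normc_def/= lecR; set A := (X in Num.sqrt X) => hS.
  have A0 : 0 <= A by rewrite addr_ge0 ?sqr_ge0.
  have An : A <= n ^+ 2.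
    by rewrite -(sqr_sqrtr A0) ler_pXn2r ?nnegrE ?sqrtr_ge0.
  have B0 : p * x - q * y <= 0.
    have AE : A = (n + (p * x - q * y)) ^+ 2 + (p * y + q * x) ^+ 2.
      by rewrite /A; ring.
    rewrite leNgt; apply/negP; move: An; rewrite AE.
    by move: (p * x - q * y) (p * y + q * x) => B C; nra.
  have : (p * x - q * y) * ((1 + t ^+ 2) / 2) <= 0.
    by rewrite pmulr_lle0 ?divr_gt0.
  have -> : (p * x - q * y) * ((1 + t ^+ 2) / 2) = - (t ^+ 2 * x) - t * y.
    by rewrite /p /q; field; rewrite gt_eqF.
  by rewrite subr_le0.
have [//|y0] := eqVneq y 0.
have x1 : 0 < 2 * (`|x| + 1) by rewrite mulr_gt0// ltr_pwDr.
(* At t = - y e, [key] reads e y^2 <= e y^2 (e x), which fails once e x is at most 1/2. *)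
pose e := (2 * (`|x| + 1))^-1; have e0 : 0 < e by rewrite invr_gt0.
have ex : e * x <= 2^-1.
  apply: le_trans (_ : e * `|x| <= _); first by rewrite ler_pM2l// ler_norm.
  rewrite ler_pdivrMl// [leRHS]mulrAC mulfV// mul1r lerDl//.
have yy : 0 < y ^+ 2 by rewrite exprn_even_gt0.
have := key (- (y * e)).
have eyy : 0 < e * y ^+ 2 by rewrite mulr_gt0.
have -> : - ((- (y * e)) ^+ 2 * x) = - ((e * y ^+ 2) * (e * x)) by ring.
have -> : - (y * e) * y = - (e * y ^+ 2) by ring.
rewrite lerN2 => h1.
have : e * y ^+ 2 * (e * x) <= e * y ^+ 2 / 2 by rewrite ler_pM2l.
by move=> /(le_trans h1); lra.
Qed.

(* The third hypothesis says that the subgradients of n are those of a multiple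
   of the square root of k + t^2, so that n^2 / (k + t^2) has derivative 0. *)
Lemma euclidean_profile (R : realType) (n : R -> R) (k : R) : 0 <= k ->
  (forall t : R, 0 < t -> [/\ 1 <= n t, t <= n t & n t <= 1 + t]) ->
  (forall t t' : R, 0 < t -> 0 < t' -> n t * (k + t * t') <= n t' * (k + t ^+ 2)) ->
  forall t : R, 0 < t -> n t ^+ 2 = 1 + t ^+ 2.
Proof.
move=> k0 nb sub.
(* For [k = 0] the inequality at [t' = 1] gives [n t <= n 1 * t], which is 1/2 for the chosen [t],
   against [1 <= n t]. *)
have {}k0 : 0 < k.
  rewrite lt_def k0 andbT; apply/eqP => kE.
  have [n1 _ _] := nb 1 ltr01.
  pose t := (2 * n 1)^-1; have t0 : 0 < t by rewrite invr_gt0; lra.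
  have tn : t * n 1 = 2^-1 by rewrite /t; field; lra.
  have := sub t 1 t0 ltr01; rewrite kE !add0r mulr1 expr2 mulrA [n 1 * t]mulrC tn.
  rewrite ler_pM2r// => nt; have [] := nb t t0; lra.
pose f t := n t ^+ 2 / (k + t ^+ 2).
have D0 (t : R) : 0 < k + t ^+ 2 by rewrite ltr_wpDr// sqr_ge0.
(* The bound on [f] is (1 + t)^2 <= 2 (1 + t^2) <= M (k + t^2). *)
pose M := 2 * (1 + k^-1).
have ki : 0 < k^-1 by rewrite invr_gt0.
have fM (t : R) : 0 < t -> 0 <= f t <= M.
  move=> t0; have [n1 nt n1t] := nb t t0.
  rewrite divr_ge0 ?sqr_ge0 ?(ltW (D0 _))//= ler_pdivrMr//.
  have -> : M * (k + t ^+ 2) = 2 * (k + 1 + t ^+ 2 + t ^+ 2 / k).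
    by rewrite /M; field; rewrite gt_eqF.
  have : 0 <= t ^+ 2 / k by rewrite divr_ge0 ?sqr_ge0// ltW.
  have : n t ^+ 2 <= (1 + t) ^+ 2 by rewrite ler_pXn2r ?nnegrE//; lra.
  by have := sqr_ge0 (1 - t); nra.
(* Squaring the hypothesis bounds [f x] times (k + x y)^2 / ((k + x^2) (k + y^2)) by [f y], and this
   factor is 1 - k (x - y)^2 / ((k + x^2) (k + y^2)). *)
have inc (x y : R) : 0 < x -> 0 < y -> f x - f y <= M / k * (x - y) ^+ 2.
  move=> x0 y0; have /andP[fx0 fxM] := fM x x0.
  have h := sub x y x0 y0.
  have [nx1 _ _] := nb x x0; have [ny1 _ _] := nb y y0.
  have xy0 : 0 < k + x * y by rewrite addr_gt0// mulr_gt0.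
  have h2 : (n x * (k + x * y)) ^+ 2 <= (n y * (k + x ^+ 2)) ^+ 2.
    by rewrite ler_pXn2r ?nnegrE// ltW// mulr_gt0//; lra.
  have Dx := D0 x; have Dy := D0 y.
  have h3 : f x * ((k + x * y) ^+ 2 / ((k + x ^+ 2) * (k + y ^+ 2))) <= f y.
    rewrite /f ler_pdivlMr// -(ler_pM2r (exprn_gt0 2 Dx)).
    have -> : n x ^+ 2 / (k + x ^+ 2) *
        ((k + x * y) ^+ 2 / ((k + x ^+ 2) * (k + y ^+ 2))) * (k + y ^+ 2) *
        (k + x ^+ 2) ^+ 2 = (n x * (k + x * y)) ^+ 2.
      by field; rewrite !gt_eqF.
    by rewrite -exprMn.
  have e : (k + x * y) ^+ 2 / ((k + x ^+ 2) * (k + y ^+ 2)) =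
      1 - k * (x - y) ^+ 2 / ((k + x ^+ 2) * (k + y ^+ 2)).
    by field; rewrite !gt_eqF.
  have b : k * (x - y) ^+ 2 / ((k + x ^+ 2) * (k + y ^+ 2)) <= (x - y) ^+ 2 / k.
    rewrite ler_pdivrMr ?mulr_gt0// mulrAC ler_pdivlMr//.
    rewrite [leLHS]mulrAC mulrC ler_wpM2l ?sqr_ge0//.
    by have := sqr_ge0 x; have := sqr_ge0 y; nra.
  move: h3; rewrite e mulrBr mulr1 lerBlDr => h3.
  have b0 : 0 <= k * (x - y) ^+ 2 / ((k + x ^+ 2) * (k + y ^+ 2)).
    by apply: divr_ge0; apply: mulr_ge0; rewrite ?sqr_ge0 ?ltW.
  rewrite lerBlDr addrC; apply: le_trans h3 _; rewrite lerD2l.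
  have -> : M / k * (x - y) ^+ 2 = M * ((x - y) ^+ 2 / k) by field; rewrite gt_eqF.
  exact: ler_pM.
have cst := quadratic_increments_const inc.
(* It remains to find the constants: the bounds on [n] at large [t] give [L = 1], and then those at
   small [t] give [k = 1]. *)
pose L := f 1.
have nL (t : R) : 0 < t -> n t ^+ 2 = L * (k + t ^+ 2).
  by move=> t0; rewrite /L -(cst t)// divfK// gt_eqF.
have L0 : 0 <= L by have /andP[] := fM 1 ltr01.
have up (t : R) : 0 < t -> L * (k + t ^+ 2) <= (1 + t) ^+ 2.
  move=> t0; rewrite -nL//; have [? ? ?] := nb t t0.
  by rewrite ler_pXn2r ?nnegrE//; lra.
have lo1 (t : R) : 0 < t -> 1 <= L * (k + t ^+ 2).
  by move=> t0; rewrite -nL//; have [? ? ?] := nb t t0; rewrite expr_ge1//; lra.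
have lot (t : R) : 0 < t -> t ^+ 2 <= L * (k + t ^+ 2).
  move=> t0; rewrite -nL//; have [? ? ?] := nb t t0.
  by rewrite ler_pXn2r ?nnegrE//; lra.
have Lk0 : 0 <= L * k by rewrite mulr_ge0// ltW.
have L1 : L <= 1.
  rewrite leNgt; apply/negP => L1; pose a := L - 1.
  have a0 : 0 < a by rewrite subr_gt0.
  pose t := 3 / a + 1; have t1 : 1 <= t by rewrite lerDr divr_ge0// ltW.
  have at_ : a * t = 3 + a by rewrite /t; field; rewrite gt_eqF.
  have /up : 0 < t by lra.
  have -> : L * (k + t ^+ 2) = L * k + (a * t) * t + t ^+ 2.
    by rewrite /a; ring.
  by rewrite at_; nra.
have L2 : 1 <= L.
  rewrite leNgt; apply/negP => L1'; pose a := 1 - L.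
  have a0 : 0 < a by rewrite subr_gt0.
  pose t := (L * k + 1) / a + 1.
  have t1 : 1 <= t by rewrite lerDr divr_ge0 ?(ltW a0)//; lra.
  have at_ : a * t = L * k + 1 + a by rewrite /t; field; rewrite gt_eqF.
  have /lot : 0 < t by lra.
  have -> : L * (k + t ^+ 2) = L * k + t ^+ 2 - (a * t) * t by rewrite /a; ring.
  by rewrite at_; nra.
have LE : L = 1 by apply/eqP; rewrite eq_le L1.
rewrite LE in up lo1 nL.
have k1 : k <= 1.
  rewrite leNgt; apply/negP => h; pose t := (k - 1) / 4.
  have t0 : 0 < t by rewrite divr_gt0// subr_gt0.
  by have := up t t0; rewrite /t; nra.
have k2 : 1 <= k.
  rewrite leNgt; apply/negP => h; pose t := (1 - k) / 2.
  have t0 : 0 < t by rewrite divr_gt0// subr_gt0.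
  by have := lo1 t t0; rewrite /t; nra.
move=> t t0; rewrite nL// mul1r; congr (_ + _).
by apply/eqP; rewrite eq_le k1.
Qed.

(** The values at 1, -1, i and -i show that P + Q and i (P - Q) are real. *)
Lemma real_on_circle_conj (C : numClosedFieldType) (A P Q : C) :
  (forall x, `|x| = 1 -> A + P * x + Q * x^-1 \is Num.real) -> Q = P^*.
Proof.
move=> real.
have h1 := real 1 (normr1 _).
have h2 : A - P - Q \is Num.real.
  by have := real (-1); rewrite normrN normr1 invrN1 !mulrN1 => /(_ erefl).
have h3 : A + P * 'i - Q * 'i \is Num.real.
  by have := real 'i; rewrite normCi invCi mulrN => /(_ erefl).
have h4 : A - P * 'i + Q * 'i \is Num.real.
  have := real (- 'i); rewrite normrN normCi invrN invCi opprK mulrN => /(_ erefl).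
  by [].
have PQ : P + Q \is Num.real.
  have -> : P + Q = ((A + P * 1 + Q * 1^-1) - (A - P - Q)) / 2 by field.
  by apply: realM; [exact: realB|rewrite realV realn].
have PQi : (P - Q) * 'i \is Num.real.
  have -> : (P - Q) * 'i = ((A + P * 'i - Q * 'i) - (A - P * 'i + Q * 'i)) / 2 by field.
  by apply: realM; [exact: realB|rewrite realV realn].
have e1 : P^* + Q^* = P + Q by have := CrealP PQ; rewrite rmorphD.
have e2 : Q^* - P^* = P - Q.
  have := CrealP PQi; rewrite rmorphM rmorphB /= conjCi => h.
  by apply: (mulIf (neq0Ci C)); rewrite -h; ring.
have : 2 * P^* = 2 * Q.
  have -> : 2 * P^* = (P^* + Q^*) - (Q^* - P^*) by ring.
  by rewrite e1 e2; ring.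
by move=> /mulfI ->//; rewrite pnatr_eq0.
Qed.

(** * The Kalton-Wood argument in the plane *)

Section KaltonWood.
Variables (R : realType) (V : normedModType R[i]) (u v : V).
Local Notation C := R[i].
Hypotheses (u1 : `|u| = 1) (v1 : `|v| = 1).
Hypothesis absN : forall a b a' b' : C, `|a| = `|a'| -> `|b| = `|b'| ->
  `|a *: u + b *: v| = `|a' *: u + b' *: v|.

Lemma unit_multiple (z : C) : exists2 x : C, `|x| = 1 & x * z = `|z|.
Proof.
have [->|z0] := eqVneq z 0; first by exists 1; rewrite ?normr1// normr0 mulr0.
exists (`|z| / z); last by rewrite divfK.
by rewrite normrM normfV normr_id mulfV// normr_eq0.
Qed.

(** Hahn-Banach gives a norming functional of r u + t v; since the norm is absolute, its values on
    [u] and [v] may be replaced by their moduli. *)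
Lemma norming_pair (r t : C) : 0 <= r -> 0 <= t ->
  exists p q : C, [/\ 0 <= p, 0 <= q, p * r + q * t = `|r *: u + t *: v| &
    forall a b, `|p * a + q * b| <= `|a *: u + b *: v|].
Proof.
move=> r0 t0; pose y := r *: u + t *: v.
have sl : scalar (fun a : C => a * `|y|) by move=> a b c; rewrite mulrDl mulrA.
have [f fE] : exists f : {scalar (C^o : lmodType C)}, forall a, f a = a * `|y|.
  pose fm := GRing.isLinear.Build C C^o C *%R (fun a : C^o => a * `|y|) sl.
  by exists (HB.pack (fun a : C^o => a * `|y|) fm : {scalar (C^o : lmodType C)}).
have Ll : linear (fun a : C^o => a *: y).
  by move=> a b c; rewrite scalerDl scalerA.
have [L LE] : exists L : {linear C^o -> V}, forall a, L a = a *: y.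
  pose Lm := GRing.isLinear.Build C C^o V *:%R (fun a : C^o => a *: y) Ll.
  by exists (HB.pack (fun a : C^o => a *: y) Lm : {linear C^o -> V}).
have [|||a|g [gl gL gn]] := @hahn_banach_complex R _ _ L f (fun w => `|w|).
- by move=> w; exact: normr_ge0.
- by move=> w z; exact: ler_normD.
- by move=> a w; exact: normrZ.
- by rewrite fE LE normrZ normrM normr_id.
have g0 : g 0 = 0.
  by have := gl 1 0 0; rewrite scale1r mul1r addr0 -[LHS]addr0 => /addrI.
have gE a b : g (a *: u + b *: v) = g u * a + g v * b.
  by rewrite gl -[b *: v]addr0 gl g0 addr0 !(mulrC _ a) !(mulrC _ b).
have [x x1 xu] := unit_multiple (g u); have [z z1 zv] := unit_multiple (g v).
have dom a b : `| `|g u| * a + `|g v| * b| <= `|a *: u + b *: v|.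
  have -> : `|g u| * a + `|g v| * b = g ((x * a) *: u + (z * b) *: v).
    by rewrite gE -xu -zv; ring.
  apply: le_trans (gn _) _; rewrite le_eqVlt; apply/orP; left; apply/eqP.
  by apply: absN; rewrite normrM ?x1 ?z1 mul1r.
exists `|g u|, `|g v|; split=> //.
apply/eqP; rewrite eq_le; apply/andP; split.
  apply: le_trans (dom r t); rewrite (@ger0_norm _ (`|g u| * r + `|g v| * t))//.
  by rewrite addr_ge0// mulr_ge0.
have gy : g y = `|y| by have := gL 1; rewrite LE fE scale1r mul1r.
rewrite -/y -[leLHS]normr_id -gy gE; apply: le_trans (ler_normD _ _) _.
by rewrite !normrM (ger0_norm r0) (ger0_norm t0).
Qed.

Variables (al be c d : C).
Hypothesis contr : forall a b z : C, `|z| = 1 ->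
  `|(a + (z - 1) * (al * a + be * b) * c) *: u +
    (b + (z - 1) * (al * a + be * b) * d) *: v| <= `|a *: u + b *: v|.

(* Rotating the second coordinate by x, the hypothesis [contr] makes
   A + P x + Q / x real for every sign x. *)
Lemma norming_pair_relation (r t p q : C) :
  p * r + q * t = `|r *: u + t *: v| ->
  (forall a b, `|p * a + q * b| <= `|a *: u + b *: v|) ->
  al * d * r * q = (be * c * t * p)^*.
Proof.
move=> pqN dom; set P := be * c * t * p; set Q := al * d * r * q.
pose A := al * c * r * p + be * d * t * q.
have real x : `|x| = 1 -> A + P * x + Q * x^-1 \is Num.real.
  move=> x1; have x0 : x != 0 by rewrite -normr_eq0 x1 oner_neq0.
  pose N := `|r *: u + t *: v|.
  have N0 : 0 <= N by exact: normr_ge0.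
  apply: (rotations_real N0) => z z1.
  (* The image of (r, x t) under the contraction, with its second coordinate multiplied by x^-1 and
     then paired with (p, q), is N + (z - 1) (A + P x + Q / x). *)
  have := contr r (x * t) z1.
  have -> : `|r *: u + (x * t) *: v| = N by apply: absN; rewrite // normrM x1 mul1r.
  apply: le_trans; set a := (X in `|X *: u + _|); set b := (X in `|_ + X *: v|).
  have -> : `|a *: u + b *: v| = `|a *: u + (x^-1 * b) *: v|.
    by apply: absN; rewrite // normrM normfV x1 invr1 mul1r.
  apply: le_trans (dom _ _); rewrite le_eqVlt; apply/orP; left; apply/eqP.
  congr `|_|; rewrite /N -pqN /a /b /A /P /Q; field.
  exact: x0.
exact: real_on_circle_conj real.
Qed.

Let n (t : R) : R := complex.Re `|1 *: u + t%:C%C *: v|.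

Let nE t : `|1 *: u + t%:C%C *: v| = (n t)%:C%C.
Proof. by rewrite RRe_real// normr_real. Qed.

(** Twice [u] and twice t v are the sum and the difference of u + t v and u - t v, which have the
    same norm. *)
Let n_bounds (t : R) : 0 < t -> [/\ 1 <= n t, t <= n t & n t <= 1 + t].
Proof.
move=> t0; have tC : 0 <= t%:C%C :> C by rewrite ler0c ltW.
have flip : `|1 *: u - t%:C%C *: v| = `|1 *: u + t%:C%C *: v|.
  by rewrite -scaleNr; apply: absN; rewrite // normrN.
split.
- rewrite -lecR -nE -(ler_pM2l (ltr0n C 2)).
  have -> : 2 * 1%:C%C = `|2 *: u| :> C by rewrite normrZ u1 mulr1 normr_nat mulr1.
  rewrite mulr_natl mulr2n -[X in _ <= X + _]flip.
  apply: le_trans (ler_normD _ _); rewrite le_eqVlt; apply/orP; left; apply/eqP.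
  by congr `|_|; rewrite addrACA addNr addr0 -scalerDl.
- rewrite -lecR -nE -(ler_pM2l (ltr0n C 2)).
  have -> : 2 * t%:C%C = `|(2 * t%:C%C) *: v| :> C.
    by rewrite normrZ v1 mulr1 ger0_norm// mulr_ge0.
  rewrite [leRHS]mulr_natl mulr2n -[X in _ <= _ + X]flip -[X in _ <= _ + X]normrN.
  apply: le_trans (ler_normD _ _); rewrite le_eqVlt; apply/orP; left; apply/eqP.
  by congr `|_|; rewrite opprB [1 *: u + _]addrC addrACA subrr addr0 -scalerDl mulrDl mul1r.
- rewrite -lecR -nE rmorphD; apply: le_trans (ler_normD _ _) _.
  by rewrite !normrZ u1 v1 normr1 !mulr1 lerD2l ger0_norm.
Qed.

(** By the relation above, the norming pair at (1, t) is proportional to (k, t) with one [k] for all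
    [t], as for a Euclidean norm, and [euclidean_profile] applies. *)
Lemma kalton_wood : be * c != 0 -> span_is_l22 u v.
Proof.
move=> bc0.
have pairs (t : R) : 0 < t -> exists p q : R, [/\ 0 <= p, 0 <= q,
    p + q * t = n t, forall t', 0 < t' -> p + q * t' <= n t' &
    al * d * q%:C%C = (be * c)^* * (t * p)%:C%C].
  move=> t0; have tC : 0 <= t%:C%C :> C by rewrite ler0c ltW.
  have [p [q [p0 q0 pq dom]]] := norming_pair ler01 tC.
  have rel := norming_pair_relation pq dom.
  have pE : p = (complex.Re p)%:C%C by rewrite RRe_real// ger0_real.
  have qE : q = (complex.Re q)%:C%C by rewrite RRe_real// ger0_real.
  move: p0 q0 pq dom rel; rewrite pE qE !ler0c.
  move: (complex.Re p) (complex.Re q) => {pE qE}p {}q p0 q0 pq dom rel.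
  exists p, q; split=> //.
  - by apply: complexI; rewrite -nE -pq rmorphD rmorphM/= mulr1.
  - move=> t' t'0; rewrite -lecR -nE rmorphD rmorphM/=.
    apply: le_trans (dom 1 t'%:C%C); rewrite mulr1 ger0_norm//.
    by rewrite -!rmorphM -rmorphD ler0c addr_ge0// mulr_ge0// ltW.
  - rewrite mulr1 in rel; rewrite rel -mulrA rmorphM/=; congr (_ * _).
    by rewrite -rmorphM; apply/CrealP; rewrite complex_real.
have [p1 [q1 [p10 q10 pq1 _ rel1]]] := pairs 1 ltr01.
have [n1 _ _] := n_bounds ltr01.
have bc0' : (be * c)^* != 0 by rewrite conjC_eq0.
(* If [q1] were 0, the relation at 1 would give [p1 = 0], while [p1 + q1] is [n 1], at least 1. *)
have q1n0 : q1 != 0.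
  apply/eqP => q0; move: rel1; rewrite q0 mulr0 mul1r => /esym/eqP.
  rewrite mulf_eq0 (negbTE bc0')/= => /eqP p0.
  have {}p0 : p1 = 0 by exact: complexI.
  by move: n1; rewrite -pq1 q0 p0 mul0r addr0 ler10.
pose k := p1 / q1.
have k0 : 0 <= k by rewrite divr_ge0.
have ad : al * d = (be * c)^* * k%:C%C.
  apply: (mulIf (x := q1%:C%C)); first by apply: contra q1n0 => /eqP/complexI ->.
  by rewrite rel1 -mulrA -rmorphM /k mul1r divfK.
(* Since k q = t p, this is the supporting inequality p + q t' <= n t' multiplied by k + t^2. *)
have sub (t t' : R) : 0 < t -> 0 < t' -> n t * (k + t * t') <= n t' * (k + t ^+ 2).
  move=> t0 t'0; have [p [q [p0 q0 pq dom rel]]] := pairs t t0.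
  have kq : k * q = t * p.
    apply: complexI; apply: (mulfI bc0').
    by rewrite -rel ad -[RHS]mulrA -rmorphM.
  have D0 : 0 < k + t ^+ 2 by rewrite ltr_wpDl// exprn_gt0.
  have := dom t' t'0; rewrite -(ler_pM2r D0); apply: le_trans.
  have -> : (p + q * t') * (k + t ^+ 2) = p * k + p * t ^+ 2 + k * q * t' + q * t' * t ^+ 2.
    by ring.
  have -> : n t * (k + t * t') = p * k + p * t * t' + k * q * t + q * t * (t * t').
    by rewrite -pq; ring.
  by rewrite kq le_eqVlt; apply/orP; left; apply/eqP; ring.
have nsq := euclidean_profile k0 n_bounds sub.
move=> a b.
have [->|a0] := eqVneq a 0.
  by rewrite scale0r add0r normrZ v1 mulr1 normr0 expr0n add0r.
have [->|b0] := eqVneq b 0.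
  by rewrite scale0r addr0 normrZ u1 mulr1 normr0 expr0n addr0.
have na : 0 < `|a| by rewrite normr_gt0.
pose tc := `|b| / `|a|; have tc0 : 0 < tc by rewrite divr_gt0// normr_gt0.
have [x tE x0] : exists2 x : R, tc = x%:C%C & 0 < x.
  have e : tc = (complex.Re tc)%:C%C by rewrite RRe_real// gtr0_real.
  by exists (complex.Re tc); rewrite // -ltcR -e.
have nx : `|1 *: u + tc *: v| ^+ 2 = 1 + tc ^+ 2.
  have := congr1 (real_complex R) (nsq x x0).
  by rewrite tE nE rmorphD rmorph1 !rmorphXn.
have -> : `|a *: u + b *: v| = `|a| * `|1 *: u + tc *: v|.
  rewrite -[X in X * _]normr_id -normrZ scalerDr !scalerA; apply: absN.
    by rewrite mulr1 normr_id.
  by rewrite /tc mulrCA mulfV ?gt_eqF// mulr1 normr_id.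
rewrite exprMn nx mulrDr mulr1 /tc expr_div_n; congr (_ + _).
by rewrite mulrCA mulfV ?mulr1// expf_neq0// gt_eqF.
Qed.

End KaltonWood.

(** A nonzero product would be the [be * c] of [kalton_wood], and the plane would be Euclidean. The
    equation on [s] lets the statement be used in the development common to both fields. *)
Lemma complex_disjoint_images (R : realType) (s : scalar_kind)
    (E X1 X2 : normedModType (scalars R s))
    (iotaE : {linear c00 (scalars R s) -> E}) (F1 F2 : set {fset nat})
    (iota1 : {linear c00 (scalars R s) -> X1})
    (iota2 : {linear c00 (scalars R s) -> X2})
    (J : {linear dual X1 -> dual X2}) (Ji : {linear dual X2 -> dual X1}) :
  s = ComplexScalars -> unconditional_frame iotaE -> combinatorial_family F1 ->
  comb_frame iotaE F1 iota1 -> comb_frame iotaE F2 iota2 ->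
  cancel Ji J -> (forall f, `|J f| = `|f|) -> (forall f, `|Ji f| = `|f|) ->
  no_l22_pair (fun i => iotaE (c00_delta _ i)) ->
  disjoint_images iota1 iota2 J.
Proof.
move=> es; subst s => frmE combF1 cf1 cf2 JiK Jn Jin nl22.
have [frm1 _ _] := cf1.
apply: (disjoint_images_of_products cf1 cf2 Jin) => j k m jk.
apply/eqP; apply: contrapT => /negP bc0; apply: (nl22 j k jk).
apply: (span_is_l22_coord frmE combF1 cf1 jk).
pose V : normedModType (scalars R ComplexScalars) := dual X1.
have l22 := @kalton_wood R V _ _ (coordf_norm frm1 j) (coordf_norm frm1 k)
  (fun a b a' b' => coord_pair_abs cf1 jk) _ _ _ _
  (fun a b z => compressed_rotation cf1 cf2 JiK Jn m a b jk) bc0.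
exact l22.
Qed.

(** * Smooth norms *)

Lemma closed_norm_le (K : numFieldType) (V : normedModType K) (c : K) :
  closed [set x : V | `|x| <= c].
Proof.
move=> x xcl; apply/ler_addgt0Pr => eps eps0.
have [y [/= yc xy]] := xcl _ (nbhsx_ballx x eps eps0).
rewrite -(subrK y x) addrC; apply: le_trans (ler_normD _ _) _.
by apply: lerD => //; move: xy; rewrite -ball_normE => /ltW.
Qed.

(** The complex disc is a closed subset of the image of the square [-1, 1]^2 under (x, y) -> x + i
    y. *)
Lemma scalar_unit_ball_compact (R : realType) (s : scalar_kind) :
  compact [set a : (scalars R s)^o | `|a| <= 1].
Proof.
case: s => /=.
  have -> : [set a : R^o | `|a| <= 1] = [set` `[(-1 : R), 1]].
    by apply/seteqP; split=> a /=; rewrite in_itv/= ler_norml.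
  exact: segment_compact.
pose g (z : R * R) : R[i]^o := z.1%:C%C + 'i%C * z.2%:C%C.
have ni : `|'i%C : R[i]| = 1 by rewrite complexiE normCi.
have gc : continuous g.
  move=> [p q]; apply/cvgrPdist_lt => eps eps0.
  have epsE : eps = (complex.Re eps)%:C%C by rewrite RRe_real// gtr0_real.
  have e0 : 0 < complex.Re eps / 2 by rewrite divr_gt0// -ltcR -epsE.
  exists (ball p (complex.Re eps / 2), ball q (complex.Re eps / 2)) => /=.
    by split; exact: nbhsx_ballx.
  move=> [p' q'] /= [pp qq]; rewrite /g/= opprD addrACA -mulrBr -!rmorphB.
  apply: le_lt_trans (ler_normD _ _) _; rewrite normrM ni mul1r.
  have nR (r : R) : `|r%:C%C| = `|r|%:C%C :> R[i].
    by rewrite normc_def/= expr0n addr0 sqrtr_sqr.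
  move: pp qq; rewrite -!ball_normE/= !nR => pp qq.
  rewrite -rmorphD epsE ltcR [ltRHS]splitr; exact: ltrD.
have Bc : compact (g @` ([set` `[(-1 : R), 1]] `*` [set` `[(-1 : R), 1]])).
  apply: continuous_compact; first exact: continuous_subspaceT.
  by apply: compact_setX; exact: segment_compact.
apply: (subclosed_compact _ Bc).
  exact: (@closed_norm_le R[i] R[i]^o 1).
move=> [x y] /=; rewrite normc_def/= -(rmorph1 (real_complex R)) lecR => h.
have h1 : x ^+ 2 + y ^+ 2 <= 1.
  rewrite -(sqr_sqrtr (addr_ge0 (sqr_ge0 x) (sqr_ge0 y))) -[leRHS](expr1n _ 2).
  by rewrite ler_pXn2r ?nnegrE ?sqrtr_ge0.
exists (x, y) => /=; last first.
  by rewrite /g/= [RHS]complexE.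
by split; rewrite in_itv/=; have := sqr_ge0 x; have := sqr_ge0 y; nra.
Qed.

Section SmoothNorms.
Variables (R : realType) (s : scalar_kind).
Notation K := (scalars R s).
Variables (V : normedModType K) (iota : {linear c00 K -> V}).
Hypothesis frm : unconditional_frame iota.
Local Notation e i := (iota (c00_delta K i)).

(** Only the first [n] coordinates count, and their moduli are at most 1 on the unit ball; the
    supremum is thus over the continuous image of a closed part of a product of discs, compact by
    Tychonoff. *)
Lemma dual_norm_attained (f : dual V) n : (forall i, (n <= i)%N -> f (e i) = 0) ->
  exists x, `|iota x| <= 1 /\ `|f (iota x)| = `|f|.
Proof.
move=> fn; pose T : topologicalType := prod_topology (fun _ : nat => K^o).
pose Phi (a : T) : V := \sum_(i < n) a i *: e i.
have Phic : continuous Phi.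
  apply: continuous_big => [|i _ a]; first exact: add_continuous.
  pose si (b : T) : K := b i.
  have sc : si b @[b --> a] --> si a by exact: (@proj_continuous nat (fun _ => K^o) i a).
  exact: (cvgZr_tmp (a := e i) sc).
have PhiE (a : T) : exists x, iota x = Phi a.
  exists (\sum_(i < n) a i *: c00_delta K i); rewrite linear_sum.
  by apply: eq_bigr => i _; rewrite linearZ.
have cube : compact [set a : T | forall i, `|a i| <= 1].
  apply: (@tychonoff nat (fun _ => K^o) (fun _ => [set b | `|b| <= 1])) => i.
  exact: scalar_unit_ball_compact.
have ballC : closed (Phi @^-1` [set v | `|v| <= 1]).
  by apply: closed_comp => [a _|]; [exact: Phic | exact: closed_norm_le].
pose h (a : T) : K^o := `|f (Phi a)|.
have hc : continuous h.
  move=> a; have fc : (f \o Phi) @ a --> f (Phi a).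
    by apply: (cvg_comp _ _ (Phic a)); exact: dual_continuous.
  exact: (cvg_comp _ _ fc (@norm_continuous K K^o (f (Phi a)))).
have hD := continuous_compact (continuous_subspaceT hc) (compact_closedI cube ballC).
have : (h @` ([set a : T | forall i, `|a i| <= 1] `&` Phi @^-1` [set v | `|v| <= 1])) `|f|.
  apply: (compact_closed (@norm_hausdorff _ K^o) hD) => B /nbhs_ballP[eps /= eps0 epsB].
  have e2 : 0 < eps / 2 by rewrite divr_gt0.
  have [x [x1 fx0 fx]] := dual_norm_approx frm f e2.
  (* Dropping the coordinates from [n] on does not change the value of [f] and does not increase the
     norm. *)
  pose r : pred nat := fun i => (i < n)%N.
  pose a : T := fun i => c00_restr r x i.
  have Pa : Phi a = iota (c00_restr r x).
    rewrite (functional_c00 iota (n := n))// => i ni.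
    by change ((i < n)%:R * x i = 0); rewrite ltnNge ni mul0r.
  have fa : f (Phi a) = f (iota x).
    have [m xm] := c00_bound x.
    rewrite Pa (functional_c00 iota (n := maxn m n)) => [|i]; last first.
      rewrite geq_max => /andP[_ ni].
      by change ((i < n)%:R * x i = 0); rewrite ltnNge ni mul0r.
    rewrite (functional_c00 iota (n := maxn m n) (x := x)) => [|i]; last first.
      by rewrite geq_max => /andP[/xm].
    rewrite !linear_sum; apply: eq_bigr => i _; rewrite !linearZ/=.
    change ((i < n)%:R * x i * f (e i) = x i * f (e i)).
    by case: ltnP => [_|/fn ->]; rewrite ?mul1r// !mulr0.
  exists (h a); split; last first.
    apply: epsB; rewrite -ball_normE /ball_/= /h fa (ger0_norm fx0).
    have fxf : f (iota x) <= `|f|.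
      rewrite -(ger0_norm fx0); apply: le_trans (dual_bound _ _) _.
      by rewrite ler_piMr.
    rewrite ger0_norm ?subr_ge0//.
    apply: le_lt_trans (_ : eps / 2 < _); first by rewrite lerBlDl.
    by rewrite ltr_pdivrMr// mulr_natr mulr2n ltrDl.
  exists a => //; split => [i|] /=.
    apply: le_trans (c00_restr_le r x i) _.
    exact: le_trans (frame_coord_le frm x i) x1.
  by rewrite Pa; apply: le_trans x1; apply: (frame_unc frm) => i; exact: c00_restr_le.
move=> [a [_ /= Pa1] ha]; have [x xP] := PhiE a.
by exists x; rewrite xP.
Qed.

Lemma sum_two_unit_scalars (a b : K) : `|a| <= 1 -> `|b| <= 1 -> a + b = 2 -> a = 1.
Proof.
case: s a b => /= a b.
  by rewrite !ler_norml => /andP[_ a1] /andP[_ b1] ab; lra.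
case: a => x y; case: b => z t; rewrite !normc_def/= -(rmorph1 (real_complex R)).
have sq (p q : R) : (Num.sqrt (p ^+ 2 + q ^+ 2))%:C%C <= 1%:C%C -> p ^+ 2 + q ^+ 2 <= 1.
  rewrite lecR => h; rewrite -(sqr_sqrtr (addr_ge0 (sqr_ge0 p) (sqr_ge0 q))).
  by rewrite -[leRHS](expr1n _ 2) ler_pXn2r ?nnegrE ?sqrtr_ge0.
move=> /sq h1 /sq h2 [xz yt]; apply/eqP; rewrite eq_complex/=.
have xz2 : x + z = 2 by rewrite xz; ring.
have {yt} yt : y + t = 0 by rewrite yt; ring.
have := sqr_ge0 y; have := sqr_ge0 t; have := sqr_ge0 (x - z) => k1 k2 k3.
have x1 : x = 1 by nra.
have y0 : y ^+ 2 = 0 by apply/eqP; rewrite eq_le k3 andbT; nra.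
by rewrite x1 eqxx/=; rewrite -sqrf_eq0 y0.
Qed.

(** If the sum had norm 2, it would attain it at a finitely supported unit vector, where, after a
    rotation, [u] and [v] would both take the value 1; smoothness there makes them equal. *)
Lemma smooth_span_strictly_convex :
  (forall x, linear_span (range (fun i => e i)) x -> `|x| = 1 -> smooth_at x) ->
  forall u v, linear_span (range (coordf (fun i => e i))) u ->
    linear_span (range (coordf (fun i => e i))) v ->
    `|u| = 1 -> `|v| = 1 -> u <> v -> `|u + v| < 2.
Proof.
move=> sm u v us vs u1 v1 uv.
have [//|uv2] := real_ltP (normr_real (u + v)) (ger0_real (ler0n K 2)).
exfalso; apply: uv.
have [m um] := coord_span_bounded frm us; have [k vk] := coord_span_bounded frm vs.
have [|x [x1 fx]] := @dual_norm_attained (u + v) (maxn m k).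
  by move=> i; rewrite geq_max => /andP[mi ki]; rewrite dual_addE um// vk// addr0.
have fx2 : `|(u + v) (iota x)| = 2.
  apply/eqP; rewrite fx eq_le uv2 andbT (le_trans (ler_normD _ _))// u1 v1.
  exact: lexx.
have fx0 : (u + v) (iota x) != 0 by rewrite -normr_eq0 fx2 pnatr_eq0.
pose l := 2 / (u + v) (iota x).
have l1 : `|l| = 1 by rewrite normrM normfV fx2 normr_nat divff// pnatr_eq0.
pose y := l *: x; have yE : iota y = l *: iota x by rewrite linearZ.
have y1 : `|iota y| <= 1 by rewrite yE normrZ l1 mul1r.
have uvy : u (iota y) + v (iota y) = 2.
  by rewrite -dual_addE yE dual_scaler divfK.
have bd (g : dual V) : `|g| = 1 -> `|g (iota y)| <= 1.
  by move=> g1; apply: le_trans (dual_bound _ _) _; rewrite g1 mul1r.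
have uy := sum_two_unit_scalars (bd u u1) (bd v v1) uvy.
have vy : v (iota y) = 1.
  by apply: (sum_two_unit_scalars (bd v v1) (bd u u1)); rewrite addrC.
have ny : `|iota y| = 1.
  apply/eqP; rewrite eq_le y1/=; have := dual_bound u (iota y).
  by rewrite uy normr1 u1 mul1r.
have [|f [_ uniq]] := sm (iota y) _ ny; last first.
  by rewrite -(uniq u)// -(uniq v).
have [n yn] := c00_bound y.
exists n, (fun i => y i), (fun i => e i); split=> [i|]; first by exists (i : nat).
exact: functional_c00.
Qed.

End SmoothNorms.

(** * The permutation *)

Section Conclusion.
Variables (R : realType) (s : scalar_kind).
Notation K := (scalars R s).
Variables (E : normedModType K) (iotaE : {linear c00 K -> E}).
Hypothesis frmE : unconditional_frame iotaE.
Variables (F1 F2 : set {fset nat}).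
Hypotheses (combF1 : combinatorial_family F1) (combF2 : combinatorial_family F2).
Variables (X1 X2 : normedModType K).
Variables (iota1 : {linear c00 K -> X1}) (iota2 : {linear c00 K -> X2}).
Hypothesis cf1 : comb_frame iotaE F1 iota1.
Hypothesis cf2 : comb_frame iotaE F2 iota2.
Variables (J : {linear dual X1 -> dual X2}).
Hypothesis Jiso : surjective_isometry J.
Local Notation eE i := (iotaE (c00_delta K i)).
Local Notation e1 i := (iota1 (c00_delta K i)).
Local Notation e2 i := (iota2 (c00_delta K i)).
Local Notation ec1 := (coordf (fun j => iota1 (c00_delta K j))).
Local Notation ec2 := (coordf (fun j => iota2 (c00_delta K j))).
Local Notation Z1 := (coordf_closed_span (fun i => e1 i)).
Local Notation Z2 := (coordf_closed_span (fun i => e2 i)).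

Variable W : set (dual E).
Hypothesis WZ : forall (a : K) u, W u -> W (a *: u).
Hypothesis Wfin : forall (u : dual E) n, (forall i, (n <= i)%N -> u (eE i) = 0) -> W u.
Hypothesis Wsc : forall u v, W u -> W v -> `|u| = 1 -> `|v| = 1 -> u <> v ->
  `|u + v| < 2.

Lemma compact_closed_span : compact_family F1 -> compact_family F2 -> J @` Z1 = Z2.
Proof.
move=> cF1 cF2; have [Ji [JK JiK Jin]] := isometry_inverse Jiso.
have [Jn _] := Jiso; apply/seteqP; split.
  exact: (image_closed_span frmE combF1 combF2 cf1 cf2 JiK Jn WZ Wfin Wsc cF2).
move=> f Zf; exists (Ji f); last exact: JiK.
apply: (image_closed_span frmE combF2 combF1 cf2 cf1 JK Jin WZ Wfin Wsc cF1).
by exists f.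
Qed.

Lemma isometry_permutation :
  (forall (g : dual X2) (h : dual E), admissible F2 iota2 g ->
    (forall i, h (eE i) = g (e2 i)) -> W h) ->
  disjoint_embeddings (fun i => eE i) W \/
    (s = ComplexScalars /\ no_l22_pair (fun i => eE i)) ->
  weak_star_continuous J \/ J @` Z1 = Z2 ->
  exists (pi : nat -> nat) (omega : nat -> K),
    [/\ bijective pi, permute_family pi F1 = F2, forall i, `|omega i| = 1
      & forall i, J (ec1 i) = omega i *: ec2 (pi i)].
Proof.
move=> Wadm dis lim; have [Ji [JK JiK Jin]] := isometry_inverse Jiso.
have [Jn _] := Jiso.
have dJ : disjoint_images iota1 iota2 J.
  case: dis => [dE|[es nl22]].
    exact: (disjoint_embeddings_disjoint frmE combF1 combF2 cf1 cf2 JiK Jn WZ Wfin Wsc Wadm).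
  exact: (complex_disjoint_images es frmE combF1 cf1 cf2 JiK Jn Jin nl22).
have cl : coordinatewise_limits iota1 iota2 J Ji.
  case: lim => [wJ|JZ].
    exact: (weak_star_limits cf1 wJ).
  exact: (closed_span_limits cf1 cf2 JK Jn JZ).
have [pi [tau [omega [pit tpi om Jpi]]]] := coordinate_permutation cf1 cf2 JiK Jn dJ cl.
exists pi, omega; split=> //; first by exists tau.
apply/seteqP; split=> [_ [A FA <-]|B FB].
  exact: (permuted_family frmE combF1 combF2 cf1 cf2 JiK Jn WZ Wfin Wsc (can_inj pit) om Jpi).
(* The other inclusion is the same statement for [Ji], which realizes [tau] with the inverse
   signs. *)
have om' k : `|(omega (tau k))^-1| = 1 by rewrite normfV om invr1.
have Jtau k : Ji (ec2 k) = (omega (tau k))^-1 *: ec1 (tau k).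
  have o0 : omega (tau k) != 0 by rewrite -normr_eq0 om oner_neq0.
  by rewrite -[ec1 _]JK Jpi tpi linearZ scalerA mulVf// scale1r.
exists [fset tau i | i in B]%fset.
  exact: (permuted_family frmE combF2 combF1 cf2 cf1 JK Jin WZ Wfin Wsc (can_inj tpi) om' Jtau).
apply/fsetP => i; apply/imfsetP/idP => /= [[_ /imfsetP[k /= kB ->] ->]|iB].
  by rewrite tpi.
by exists (tau i); rewrite ?tpi//; apply/imfsetP; exists i.
Qed.

End Conclusion.

Theorem theorem2p1 (R : realType) (s : scalar_kind)
    (E : completeNormedModType (scalars R s)) (ee : nat -> E)
    (F1 F2 : set {fset nat})
    (X1 : completeNormedModType (scalars R s))
    (iota1 : {linear c00 (scalars R s) -> X1})
    (X2 : completeNormedModType (scalars R s))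
    (iota2 : {linear c00 (scalars R s) -> X2})
    (J : {linear dual X1 -> dual X2}) :
  normalized_unconditional_basis ee ->
  combinatorial_family F1 -> combinatorial_family F2 ->
  is_comb_space F1 ee iota1 -> is_comb_space F2 ee iota2 ->
  surjective_isometry J ->
  let e1 i := iota1 (c00_delta (scalars R s) i) in
  let e2 i := iota2 (c00_delta (scalars R s) i) in
  let maps_Z1_onto_Z2 := J @` coordf_closed_span e1 = coordf_closed_span e2 in
  let conclusion := exists (pi : nat -> nat) (omega : nat -> scalars R s),
    [/\ bijective pi, permute_family pi F1 = F2, forall i, `|omega i| = 1
      & forall i, J (coordf e1 i) = omega i *: coordf e2 (pi i)] in
  (strictly_convex (dual E) ->
   disjoint_embeddings ee setT \/ (s = ComplexScalars /\ no_l22_pair ee) ->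
     (weak_star_continuous J \/ maps_Z1_onto_Z2 -> conclusion) /\
     (compact_family F1 -> compact_family F2 -> maps_Z1_onto_Z2)) /\
  (compact_family F1 -> compact_family F2 ->
   strictly_convex (dual E) \/
     (forall x : E, linear_span (range ee) x -> `|x| = 1 -> smooth_at x) ->
   disjoint_embeddings ee (linear_span (range (coordf ee))) \/
     (s = ComplexScalars /\ no_l22_pair ee) ->
     maps_Z1_onto_Z2 /\ conclusion).
Proof.
move=> be cF1 cF2 sp1 sp2 iso e1 e2 maps concl.
have [iotaE [frmE eeE]] := basis_frame be.
have eeF : ee = fun i => iotaE (c00_delta (scalars R s) i).
  by apply/funext => i; rewrite eeE.
subst ee.
have cf1 := comb_space_frame frmE cF1 sp1.
have cf2 := comb_space_frame frmE cF2 sp2.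
split=> [sc dis|comp1 comp2 smooth dis].
  (* Under strict convexity of the whole dual, [W] is everything. *)
  have WZ (a : scalars R s) (u : dual E) : [set: dual E] u -> [set: dual E] (a *: u) by [].
  have Wfin (u : dual E) n : (forall i, (n <= i)%N -> u (iotaE (c00_delta _ i)) = 0) ->
    [set: dual E] u by [].
  have Wsc (u v : dual E) (_ : [set: dual E] u) (_ : [set: dual E] v) := sc u v.
  split=> [lim|comp1 comp2].
    by apply: (isometry_permutation frmE cF1 cF2 cf1 cf2 iso WZ Wfin Wsc).
  exact: (compact_closed_span frmE cF1 cF2 cf1 cf2 iso WZ Wfin Wsc comp1 comp2).
(* In the compact case admissible functionals on [X2] are finitely supported, so it suffices to know
   strict convexity, and to restrict embeddings, on the span of the coordinate functionals. *)
pose W := linear_span (range (coordf (fun i => iotaE (c00_delta (scalars R s) i)))).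
have Wfin (u : dual E) n (un : forall i, (n <= i)%N -> u (iotaE (c00_delta _ i)) = 0) :
  W u := bounded_coord_span frmE un.
have WZ (a : scalars R s) (u : dual E) : W u -> W (a *: u).
  move=> /(coord_span_bounded frmE)[n un]; apply: (Wfin _ n) => i ni.
  by rewrite dual_scaleE un// mulr0.
have Wsc (u v : dual E) : W u -> W v -> `|u| = 1 -> `|v| = 1 -> u <> v -> `|u + v| < 2.
  case: smooth => [sc _ _|sm]; first exact: sc.
  exact: (smooth_span_strictly_convex frmE sm).
have Wadm (g : dual X2) (h : dual E) : admissible F2 iota2 g ->
    (forall i, h (iotaE (c00_delta _ i)) = g (iota2 (c00_delta _ i))) -> W h.
  move=> /(compact_admissible_bounded comp2)[n gn] hg.
  by apply: (Wfin _ n) => i ni; rewrite hg gn.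
have mp := compact_closed_span frmE cF1 cF2 cf1 cf2 iso WZ Wfin Wsc comp1 comp2.
split=> //.
by apply: (isometry_permutation frmE cF1 cF2 cf1 cf2 iso WZ Wfin Wsc Wadm) => //; right.
Qed.
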